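(* There exists a tree $T$ such that the James tree space $JT$ is weakly Lindelöf determined and the dual space $JT^\ast$ admits neither an equivalent strictly convex norm nor an equivalent Kadec norm.
   Context: A tree is a partially ordered set $(T,\prec)$ such that for every $t\in T$ the set $\{s\in T : s\prec t\}$ is well ordered by $\prec$. A chain is a totally ordered subset of $T$; a segment is a chain $\sigma$ such that whenever $s\prec t\prec u$ and $s,u\in\sigma$, then $t\in\sigma$. The James tree space $JT$ is the completion of $c_{00}(T)=\{f\in\mathbb{R}^T : f \text{ has finite support}\}$ under the norm $\|f\| = \sup \left(\sum_{i=1}^n \left(\sum_{t\in \sigma_i}f(t)\right)^2\right)^{1/2}$, the supremum running over all finite families of pairwise disjoint segments $\sigma_1,\ldots,\sigma_n$ of $T$. A Banach space $X$ is weakly Lindelöf determined if its dual unit ball with the weak$^\ast$ topology is a Corson compact space (i.e. homeomorphic to a compact subset of some $\{x\in\mathbb{R}^\Gamma : x_\gamma\neq 0 \text{ for at most countably many }\gamma\}$ with the product topology). A norm is strictly convex if its unit sphere contains no nondegenerate segment; it is a Kadec norm if the weak topology and the norm topology coincide on its unit sphere. *)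

(* Defs.v *)
From HB Require Import structures.
From mathcomp Require Import all_boot all_order all_algebra.
From mathcomp Require Import all_classical all_reals all_analysis.
From mathcomp Require wochoice.

Set Implicit Arguments.
Unset Strict Implicit.
Unset Printing Implicit Defensive.
Import Order.TTheory GRing.Theory Num.Theory.
Import numFieldNormedType.Exports.
Local Open Scope classical_set_scope.
Local Open Scope ring_scope.

(* Real functions are given the codomain [R^o], which is [R] seen as a module
   over itself, so that [V -> R^o] is an [lmodType R]. *)

Section dual.
Context {R : realType} (V : normedModType R).

Definition dual_pred : {pred V -> R^o} :=
  [pred f : V -> R^o | `[< linear f /\ continuous f >]].

Record dual : Type := Dual { dual_fun :> V -> R^o ; _ : dual_fun \in dual_pred }.

HB.instance Definition _ := [isSub for dual_fun].
HB.instance Definition _ := [Choice of dual by <:].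

Lemma dual_submod_closed : submod_closed dual_pred.
Proof.
split.
  apply/asboolP; split; last exact: cst_continuous.
  by move=> a x y; rewrite /= /GRing.zero /= scaler0 addr0.
move=> a f g /asboolP[lf cf] /asboolP[lg cg]; apply/asboolP; split.
  move=> k x y; rewrite !fctE lf lg !scalerDr !scalerA (mulrC a k) -!addrA.
  by congr (_ + _); rewrite addrCA.
by move=> x; apply: cvgD; [apply: cvgZr; exact: cf|exact: cg].
Qed.

HB.instance Definition _ :=
  GRing.isSubmodClosed.Build _ _ dual_pred dual_submod_closed.
HB.instance Definition _ := [SubChoice_isSubLmodule of dual by <:].

Lemma dualP (f : dual) : linear f /\ continuous f.
Proof. by case: f => f /= /asboolP. Qed.

Definition dual_norm (f : dual) : R :=
  sup [set `|f x| | x in [set x | `|x| <= 1]].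

Let pack_linear (f : V -> R^o) (lf : linear f) : {linear V -> R^o} :=
  HB.pack f (GRing.isLinear.Build _ _ _ _ _ lf).

Lemma dual_has_sup (f : dual) :
  has_sup [set `|f x| | x in [set x | `|x| <= 1]].
Proof.
split; first by exists `|f 0|, 0 => //=; rewrite normr0.
have [lf cf] := dualP f.
have /bounded_funP/(_ 1)[M fM] :=
  @continuous_linear_bounded _ _ _ 0 (pack_linear lf) (cf 0).
by exists M => _ [x /= x1 <-]; exact: fM.
Qed.

Lemma dual_norm_ub (f : dual) x : `|x| <= 1 -> `|f x| <= dual_norm f.
Proof. by move=> x1; apply: (sup_upper_bound (dual_has_sup f)); exists x. Qed.

Lemma dual_norm_lub (f : dual) M :
  (forall x, `|x| <= 1 -> `|f x| <= M) -> dual_norm f <= M.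
Proof.
move=> fM; apply: ge_sup; first by case: (dual_has_sup f).
by move=> _ [x /= x1 <-]; exact: fM.
Qed.

Lemma dual_normD (f g : dual) :
  dual_norm (f + g) <= dual_norm f + dual_norm g.
Proof.
apply: dual_norm_lub => x x1; apply: le_trans (ler_normD _ _) _.
by apply: lerD; exact: dual_norm_ub.
Qed.

Lemma dual_normZ (a : R) (f : dual) :
  dual_norm (a *: f) = `|a| * dual_norm f.
Proof.
have le_normZ b g : dual_norm (b *: g) <= `|b| * dual_norm g.
  apply: dual_norm_lub => x x1; rewrite [leLHS](normrM b).
  by rewrite ler_wpM2l// dual_norm_ub.
apply/eqP; rewrite eq_le le_normZ /=.
have [->|a0] := eqVneq a 0.
  rewrite normr0 mul0r; apply: le_trans (@dual_norm_ub _ 0 _) => //.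
  by rewrite normr0.
rewrite -ler_pdivlMl ?normr_gt0// -normfV.
by rewrite -[in leLHS](scalerK a0 f).
Qed.

Lemma dual_norm0_eq0 (f : dual) : dual_norm f = 0 -> f = 0.
Proof.
move=> f0; apply/val_inj/funext => x /=.
have [lf _] := dualP f.
have fZ b y : f (b *: y) = b * f y by rewrite (scalable_linear lf).
have [->|x0] := eqVneq x 0; first by rewrite -[in LHS](scale0r 0) fZ mul0r.
have : `|f (`|x|^-1 *: x)| <= 0.
  rewrite -f0; apply: dual_norm_ub.
  by rewrite normrZ normfV normr_id mulVf// normr_eq0.
rewrite normr_le0 fZ mulf_eq0 invr_eq0 normr_eq0 (negbTE x0).
by move=> /eqP.
Qed.

HB.instance Definition _ :=
  Lmodule_isNormed.Build R dual dual_normD dual_normZ dual_norm0_eq0.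

End dual.

Section weak_topologies.
Context {R : realType} (V : normedModType R).

Definition weak_star : topologicalType :=
  initial_topology (@dual_fun R V : dual V -> {ptws V -> R}).

Definition dual_ball : set weak_star := [set f : dual V | `|f| <= 1].

Definition weak : topologicalType :=
  initial_topology ((fun x f => f x) : V -> {ptws dual V -> R}).

End weak_topologies.

Section renorming.
Context {R : realType} (V : normedModType R).

Definition equivalent_norm (N : V -> R) : Prop :=
  [/\ forall x y, N (x + y) <= N x + N y,
      forall (a : R) x, N (a *: x) = `|a| * N x,
      forall x, N x = 0 -> x = 0 &
      exists c C : R,
        [/\ 0 < c, 0 < C & forall x, c * `|x| <= N x <= C * `|x|]].

Definition unit_sphere (N : V -> R) : set V := [set x | N x = 1].

Definition strictly_convex_norm (N : V -> R) : Prop :=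
  ~ exists x y : V, x <> y /\
      forall t : R, 0 <= t <= 1 -> unit_sphere N ((1 - t) *: x + t *: y).

Definition norm_open (N : V -> R) (U : set V) : Prop :=
  forall x, U x -> exists2 e : R, 0 < e & forall y, N (y - x) < e -> U y.

(* The traces on the sphere of the [N]-open sets and of the weakly open sets
   are the same. Equivalent norms have the same continuous linear functionals,
   so [weak] is also the weak topology of [(V, N)]. *)
Definition kadec_norm (N : V -> R) : Prop :=
  [set U `&` unit_sphere N | U in norm_open N] =
  [set U `&` unit_sphere N | U in @open (weak V)].

End renorming.

Definition homeomorphic_sets (S S' : topologicalType)
    (A : set S) (B : set S') : Prop :=
  exists (f : S -> S') (g : S' -> S),
    [/\ {within A, continuous f}, {within B, continuous g},
        f @` A = B, g @` B = A & {in A, cancel f g}].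

Definition sigma_product (R : realType) (G : Type) : set {ptws G -> R} :=
  [set x | countable [set g | x g <> 0]].

Definition corson_compact (R : realType) (S : topologicalType) (A : set S) :
    Prop :=
  exists (G : Type) (K : set {ptws G -> R}),
    [/\ compact K, K `<=` @sigma_product R G & homeomorphic_sets A K].

Definition weakly_Lindelof_determined (R : realType) (V : normedModType R) :
    Prop :=
  corson_compact R (@dual_ball R V).

Definition is_tree d (T : porderType d) : Prop :=
  forall t : T, wochoice.wo_chain (<=%O : rel T) [pred s | (s < t)%O].

Definition segment d (T : porderType d) (s : set T) : Prop :=
  total_on s (fun x y => (x <= y)%O) /\
  forall x y z : T, (x < y)%O -> (y < z)%O -> s x -> s z -> s y.

Section c00.
Context (R : realType) (T : choiceType).

Definition c00_pred : {pred T -> R^o} :=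
  [pred f : T -> R^o | `[< finite_set [set t | f t <> 0] >]].

Record c00 : Type := C00 { c00_fun :> T -> R^o ; _ : c00_fun \in c00_pred }.

HB.instance Definition _ := [isSub for c00_fun].
HB.instance Definition _ := [Choice of c00 by <:].

Lemma c00_submod_closed : submod_closed c00_pred.
Proof.
split.
  apply/asboolP; apply: sub_finite_set (finite_set0 T) => t; exact.
move=> a f g /asboolP ff /asboolP fg; apply/asboolP.
have fU : finite_set ([set t | f t <> 0] `|` [set t | g t <> 0]).
  by rewrite finite_setU.
apply: sub_finite_set fU => t /= h.
have [f0|/eqP f0] := eqVneq (f t) 0; last by left.
by right => g0; apply: h; rewrite !fctE f0 g0 scaler0 addr0.
Qed.

HB.instance Definition _ :=
  GRing.isSubmodClosed.Build _ _ c00_pred c00_submod_closed.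
HB.instance Definition _ := [SubChoice_isSubLmodule of c00 by <:].

End c00.

Section james_tree_space.
Context (R : realType) d (T : porderType d).

(* The supremum is that of a bounded set, since [f] has finite support: all its
   elements are at most [\sum_(t \in setT) `|f t|]. Empty [s i] contribute 0. *)
Definition james_tree_norm (f : c00 R T) : R :=
  sup [set r | exists n (s : 'I_n -> set T),
    [/\ forall i, segment (s i), trivIset setT s &
        r = Num.sqrt (\sum_(i < n) (\sum_(t \in s i) f t) ^+ 2)]].

(* The completion is unique up to a linear isometry: [X] is a Banach space with
   a dense isometric copy of [c00] under the James tree norm. *)
Definition is_james_tree_space (X : completeNormedModType R) : Prop :=
  exists j : {linear c00 R T -> X},
    (forall f, `|j f| = james_tree_norm f) /\ dense (range j).

End james_tree_space.

(* Main.v *)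
Require Import Defs.
From HB Require Import structures.
From mathcomp Require Import all_boot all_order all_algebra.
From mathcomp Require Import all_classical all_reals all_analysis.
From mathcomp Require wochoice.
From mathcomp Require Import lra ring.

(** The tree [T] consists of the well-ordered subsets of the lexicographic square
    of [R], ordered by end-extension. Such sets are countable, hence so are the
    chains of [T]. For a bounded functional [x] on [JT] and [e > 0], the antichains
    of [{t | e < x(e_t)}] are bounded in size, as [JT] is a Hilbert space on
    antichains; so this set is covered by finitely many chains, [x] has countable
    support, and the coordinates embed the dual ball into a Sigma-product.

    Let [N] be an equivalent norm on the dual and [b_t] the functional summing
    along [{r | r <= t}]. The function [rho t = inf_{u >= t} N(b_u)] is monotone,
    and Kurepa's argument yields a node [t] with uncountably many extensions [s_g]
    such that [rho] takes the same value at [t], at all [s_g] and at infinitely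
    many disjoint extensions of each [s_g]. The functionals of disjoint segments
    satisfy an upper 2-estimate, so their averages tend to [0] in norm; by
    convexity of [N] this forces [N(b_t) = rho t], and likewise at each [s_g].
    Thus [N] is constant on [b_t] and all [b_{s_g}]. Since [b_{s_g} - b_t] is weakly
    null along any sequence of [g]'s but of norm at least [1], [N] is not Kadec.
    Averaging again, [N((b_t + b_{s_g})/2) >= N(b_t)] for some [g], and the sphere
    of [N] contains a segment. *)

Set Implicit Arguments.
Unset Strict Implicit.
Unset Printing Implicit Defensive.
Import Order.TTheory GRing.Theory Num.Theory.
Import numFieldNormedType.Exports.
Local Open Scope classical_set_scope.
Local Open Scope ring_scope.

(** * The tree of well-ordered subsets of a linear order *)

Section well_ordered_sets.
Context d (E : orderType d).

Definition wo_set (A : set E) : Prop :=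
  forall B, B `<=` A -> B !=set0 ->
    exists2 m, B m & forall b, B b -> (m <= b)%O.

Lemma wo_setS (A B : set E) : B `<=` A -> wo_set A -> wo_set B.
Proof. by move=> BA wA C CB; apply: wA; exact: subset_trans BA. Qed.

Lemma wo_setU1 (A : set E) e : wo_set A -> (forall a, A a -> (a < e)%O) ->
  wo_set (A `|` [set e]).
Proof.
move=> wA Ae B BAe [b Bb].
have [[c [Bc Ac]]|nA] := pselect ((B `&` A) !=set0).
  have [||m [Bm Am] mP] := wA (B `&` A); [exact: subIsetr|by exists c|].
  exists m => // x Bx; have [Ax|->] := BAe _ Bx; first exact: mP.
  exact/ltW/Ae.
have Be x : B x -> x = e.
  by move=> Bx; have [Ax|//] := BAe _ Bx; case: nA; exists x.
by exists b => // x /Be ->; rewrite (Be _ Bb).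
Qed.

Definition initial_part (A B : set E) : Prop :=
  A `<=` B /\ forall a b, A a -> B b -> (b <= a)%O -> A b.

Lemma initial_part_refl A : initial_part A A.
Proof. by split. Qed.

Lemma initial_part_trans B A C :
  initial_part A B -> initial_part B C -> initial_part A C.
Proof.
move=> [AB dA] [BC dB]; split; first exact: subset_trans BC.
by move=> a c Aa Cc ca; apply: (dA a) => //; apply: (dB a) => //; exact: AB.
Qed.

Lemma initial_part_anti A B : initial_part A B -> initial_part B A -> A = B.
Proof. by move=> [AB _] [BA _]; apply/seteqP. Qed.

Lemma initial_part_subset A B C : initial_part A C -> initial_part B C ->
  A `<=` B -> initial_part A B.
Proof.
by move=> [AC dA] [BC dB] AB; split=> // a b Aa Bb; apply: dA => //; exact: BC.
Qed.

Definition wo_pred : {pred set E} := [pred A | `[< wo_set A >]].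

Record wotree : Type :=
  WOTree { wotree_set :> E -> Prop; _ : wotree_set \in wo_pred }.

HB.instance Definition _ := [isSub for wotree_set].
HB.instance Definition _ := [Choice of wotree by <:].

Lemma wotreeP (t : wotree) : wo_set t.
Proof. by case: t => A /= /asboolP. Qed.
Arguments wotreeP : clear implicits.

Definition mk_wotree (A : set E) (wA : wo_set A) : wotree :=
  WOTree (introT (asboolP (wo_set A)) wA : A \in wo_pred).

Definition wotree_le (s t : wotree) : bool := `[< initial_part s t >].

Fact wotree_le_refl : reflexive wotree_le.
Proof. by move=> t; apply/asboolP; exact: initial_part_refl. Qed.

Fact wotree_le_anti : antisymmetric wotree_le.
Proof.
move=> s t /andP[/asboolP st /asboolP ts]; apply/val_inj.
exact: initial_part_anti.
Qed.

Fact wotree_le_trans : transitive wotree_le.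
Proof.
move=> t s u /asboolP st /asboolP tu; apply/asboolP.
exact: initial_part_trans tu.
Qed.

Fact wotree_display : Order.disp_t. Proof. exact: Order.Disp tt tt. Qed.

HB.instance Definition _ := Order.Le_isPOrder.Build wotree_display wotree
  wotree_le_refl wotree_le_anti wotree_le_trans.

Lemma wotree_leP (s t : wotree) : reflect (initial_part s t) (s <= t)%O.
Proof. exact: asboolP. Qed.

Lemma wotree_ltP (s t : wotree) :
  (s < t)%O -> initial_part s t /\ exists2 e, t e & ~ s e.
Proof.
rewrite lt_neqAle => /andP[/eqP st /wotree_leP it]; split => //.
have [ts|/nonsubset[e [te se]]] := pselect (wotree_set t `<=` s); last by exists e.
by case: st; apply/val_inj/seteqP; split => //; case: it.
Qed.

(** For a nonempty family of nodes below [t], let [e] be the least element of [t] missing from some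
    member [s]. Every element of [s] lies below [e], hence in each member by minimality of [e], so
    [s] is the least member. *)
Lemma wotree_is_tree : is_tree wotree.
Proof.
move=> t; apply: wochoice.antisymmetric_wo_chain.
  by move=> x y _ _; exact: le_anti.
move=> A At [s0 As0].
have At' s : s \in A -> initial_part s t /\ exists2 e, t e & ~ s e.
  by move=> sA; apply/wotree_ltP/At.
have [||e [te [s As nse]] eP] :=
    wotreeP t ([set e | t e /\ exists2 s : wotree, s \in A & ~ s e]).
- by move=> e [].
- by have [_ [e te s0e]] := At' _ As0; exists e; split => //; exists s0.
exists s; split => // r Ar; apply/wotree_leP.
have [st _] := At' _ As; have [rt _] := At' _ Ar.
apply: (initial_part_subset st rt) => a sa.
apply: contrapT => nra; apply: nse; case: st => st ds; apply: (ds a) => //.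
by apply: eP; split; [exact: st|exists r].
Qed.

(** Under end-extension nothing new appears below an element of a member of the chain. So the least
    element of the trace of [B] on one member is least in all of [B], and the union is well
    ordered. *)
Lemma wotree_chain_ub (C : set wotree) : total_on C (fun x y => (x <= y)%O) ->
  exists u : wotree, (forall t, C t -> (t <= u)%O) /\
    wotree_set u = \bigcup_(t in C) wotree_set t.
Proof.
move=> totC; have Cdown t x a : C t -> t a -> (\bigcup_(t in C) wotree_set t) x ->
    (x <= a)%O -> t x.
  move=> Ct ta [s Cs sx] xa.
  have [/wotree_leP[_ ts]|/wotree_leP[st _]] := totC _ _ Ct Cs.
    exact: (ts a).
  exact: st.
have wU : wo_set (\bigcup_(t in C) wotree_set t).
  move=> B BU [b Bb]; have [t Ct tb] := BU _ Bb.
  have [||m [Bm tm] mP] := wotreeP t (B `&` wotree_set t); first exact: subIsetr.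
    by exists b.
  exists m => // x Bx; rewrite leNgt; apply/negP => xm.
  have /mP : (B `&` wotree_set t) x by split => //; apply: Cdown Ct tm (BU _ Bx) (ltW xm).
  by rewrite leNgt xm.
exists (mk_wotree wU); split => // t Ct; apply/wotree_leP; split => /=.
  by move=> x tx; exists t.
by move=> a b ta Ub ba; exact: Cdown Ct ta Ub ba.
Qed.

(* A proper initial part [t] of the union [u] of the chain is determined by the
   least element of [u] outside [t]. *)
Lemma wotree_chain_countable (C : set wotree) :
  (forall A, wo_set A -> countable A) ->
  total_on C (fun x y => (x <= y)%O) -> countable C.
Proof.
move=> woc totC; have [u [Cu _]] := wotree_chain_ub totC.
pose g e := mk_wotree (wo_setS (@subIsetl _ _ [set x | (x < e)%O]) (wotreeP u)).
have Cg : C `<=` u |` (g @` wotree_set u).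
  move=> t Ct; have [->|tu] := eqVneq t u; [by left|right].
  have /wotree_ltP[[tuS td] [e0 ue0 nte0]] : (t < u)%O by rewrite lt_neqAle tu Cu.
  have [||e [ue nte] eP] := wotreeP u (wotree_set u `\` t).
  - exact: subDsetl.
  - by exists e0.
  exists e => //; apply/val_inj/seteqP; split => x /=.
    move=> [ux xe]; apply: contrapT => ntx.
    by have := eP x (conj ux ntx); rewrite leNgt xe.
  move=> tx; split; first exact: tuS.
  by rewrite ltNge; apply/negP => ex; apply: nte; exact: (td x).
apply: sub_countable (subset_card_le Cg) _.
rewrite -bigcup2E; apply: bigcup_countable => // -[_|[_|//]] /=.
- exact: countable1.
- by apply: sub_countable (card_image_le _ _) _; exact/woc/wotreeP.
Qed.

End well_ordered_sets.

Arguments wotreeP {d E} t B.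

(** Disjointness is required for all choices of [u i] above [s i], since the averaging arguments
    choose the [u i] later, close to an infimum. *)
Definition fan d (T : porderType d) (I : Type) (t : T) (s : I -> T) : Prop :=
  (forall i, (t < s i)%O) /\
  forall u : I -> T, (forall i, (s i <= u i)%O) ->
    trivIset setT (fun i => [set r | (t < r <= u i)%O]).

(** * Fans of one-point end-extensions *)

Section wotree_rcons.
Context d (E : orderType d).
Implicit Types (t : wotree E) (e : E).

Definition wotree_rcons t e (te : forall a, t a -> (a < e)%O) : wotree E :=
  mk_wotree (wo_setU1 (wotreeP t) te).

Lemma wotree_rcons_gt t e te : (t < @wotree_rcons t e te)%O.
Proof.
rewrite lt_neqAle; apply/andP; split.
  apply/eqP => /(congr1 (fun s : wotree E => s e)) /= tE.
  have : t e by rewrite tE; right.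
  by move/te; rewrite ltxx.
apply/wotree_leP; split => /= [a|a b ta [//|->]]; first by left.
by rewrite leNgt te.
Qed.

Lemma wotree_rcons_fan (I : Type) t (e : I -> E)
    (te : forall i a, t a -> (a < e i)%O) :
  injective e -> fan t (fun i => wotree_rcons (te i)).
Proof.
move=> inje; split => [i|u su i j _ _ [r [/andP[tr rui] /andP[_ ruj]]]].
  exact: wotree_rcons_gt.
(* [e k] is the least element of [u k] outside [t], so every initial part of [u k] strictly above
   [t] contains it. *)
have er k : (r <= u k)%O -> r (e k).
  move=> /wotree_leP[ru rd].
  have /wotree_leP[su' sd] := su k.
  have [_ [a ra nta]] := wotree_ltP tr.
  have ue : u k (e k) by apply: su'; right.
  apply: (rd a) => //; rewrite leNgt; apply/negP => ae.
  have [//|/= aE] : wotree_rcons (te k) a.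
    by apply: (sd (e k)) => //; [right|exact: ru|exact: ltW].
  by rewrite aE ltxx in ae.
(* A common node [r] puts [e k] into [u l]; were it below [e l], it would belong to [t] together
   with [e l], which is impossible. *)
have half k l : (r <= u k)%O -> (r <= u l)%O -> ~ (e k < e l)%O.
  move=> rk rl kl; have /wotree_leP[_ sd] := su l.
  have : wotree_rcons (te l) (e k).
    apply: (sd (e l)); [by right| |exact: ltW].
    by have /wotree_leP[ru _] := rl; exact/ru/er.
  case=> [/(te k)|/= kE]; first by rewrite ltxx.
  by rewrite kE ltxx in kl.
apply: inje; apply/eqP; rewrite eq_le !leNgt.
by apply/andP; split; apply/negP; exact: half.
Qed.

End wotree_rcons.

(** * Countability of well-ordered sets and Kurepa's argument *)

Section kurepa.
Context {R : realType}.

(** The gaps between consecutive elements are disjoint open intervals; picking a rational in each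
    injects [A] into the rationals. *)
Lemma wo_set_real_countable (A : set R) : wo_set A -> countable A.
Proof.
move=> wA.
have gapP (a : R) : exists q : rat,
    A a -> a < ratr q /\ forall b, A b -> a < b -> ratr q < b.
  have [Aa|] := pselect (A a); last by exists 0.
  have [[b0 [Ab0 ab0]]|nb] := pselect ((A `&` [set b | a < b]) !=set0).
    have [||b [Ab ab] bP] := wA (A `&` [set b | a < b]).
    - exact: subIsetl.
    - by exists b0.
    have [q] := rat_in_itvoo ab; rewrite in_itv /= => /andP[aq qb].
    exists q => _; split => // c Ac ac; apply: lt_le_trans qb _.
    by apply: bP.
  have a1 : a < a + 1 by rewrite ltrDl.
  have [q] := rat_in_itvoo a1; rewrite in_itv /= => /andP[aq _].
  by exists q => _; split => // b Ab ab; case: nb; exists b.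
have [q qP] := choice gapP.
have qlt a b : A a -> A b -> a < b -> q a != q b.
  move=> Aa Ab ab; apply/eqP => qE.
  have [_ /(_ _ Ab ab)] := qP _ Aa; have [+ _] := qP _ Ab.
  by rewrite qE => bq /(lt_trans bq); rewrite ltxx.
have injq : {in A &, injective q}.
  move=> a b /set_mem Aa /set_mem Ab qE; apply/eqP.
  rewrite eq_le !leNgt; apply/andP; split; apply/negP => lt_ab.
    by have := qlt _ _ Ab Aa lt_ab; rewrite qE eqxx.
  by have := qlt _ _ Aa Ab lt_ab; rewrite qE eqxx.
by rewrite -(eq_countable (inj_card_eq injq)); exact: countableP.
Qed.

(** The first projection and all vertical fibres inherit well-ordering, so [A] sits in a countable
    union of countable fibres. *)
Lemma wo_set_lexi_countable (A : set (R *l R)) : wo_set A -> countable A.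
Proof.
move=> wA.
have wfst : wo_set (fst @` A : set R).
  move=> B BA [b Bb].
  have [||[x y] [Axy Bx] mP] := wA (A `&` [set p | B p.1]).
  - exact: subIsetl.
  - by have [p Ap pb] := BA _ Bb; exists p; split; rewrite //= pb.
  exists x => // c Bc; have [p Ap pc] := BA _ Bc.
  have := mP p (conj Ap _); rewrite /= pc => /(_ Bc).
  by rewrite leEprodlexi /= pc => /andP[].
have wsnd x : wo_set [set y | A (x, y)].
  move=> B BA [b Bb].
  have [||[x' y] [Axy [/= xE By]] mP] :=
      wA (A `&` [set p | p.1 = x /\ B p.2]).
  - exact: subIsetl.
  - by exists (x, b); split => //; exact: BA.
  exists y => // c Bc; have := mP (x, c) (conj (BA _ Bc) (conj erefl Bc)).
  by rewrite leEprodlexi /= xE lexx.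
have AE : A `<=` (fst @` A) `*`` (fun x => [set y | A (x, y)]).
  by move=> [x y] Axy; split => //; exists (x, y).
apply: sub_countable (subset_card_le AE) _.
apply: countableXR => [|x _]; exact: wo_set_real_countable.
Qed.

(* Kurepa's argument: along the nodes all of whose elements have first
   coordinate below [rho], one could otherwise extend forever. Two consecutive
   elements with the same first coordinate [rho t] fit because the order is
   lexicographic. *)
Lemma wotree_lexi_const (rho : wotree (R *l R) -> R) :
  (forall s t, (s <= t)%O -> rho s <= rho t) ->
  exists t (s : R -> wotree (R *l R)), fan t s /\
    forall g, rho (s g) = rho t /\
      exists s' : nat -> wotree (R *l R), fan (s g) s' /\
        forall n, rho (s' n) = rho t.
Proof.
move=> rhoM; pose P (t : wotree (R *l R)) := forall a, t a -> a.1 < rho t.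
(* Zorn's lemma applies: [P] survives unions of chains because [rho] at the union is at least [rho]
   at each member. *)
have [t Pt tmax] : exists2 t, P t & forall s, P s -> (t <= s)%O -> s = t.
  pose S := {t : wotree (R *l R) | P t}.
  have [|||C totC|[t Pt] tmax] := @Zorn S (fun s t => (sval s <= sval t)%O).
  - by move=> ?; exact: lexx.
  - by move=> r s t; exact: le_trans.
  - by move=> [s Ps] [t Pt] /= st ts; apply/eq_exist/le_anti/andP.
  - have [|u [uC uE]] := @wotree_chain_ub _ _ (sval @` C).
      by move=> _ _ [s Cs <-] [t Ct <-]; exact: totC.
    have Pu : P u.
      move=> a; rewrite -/(wotree_set u a) uE => -[_ [[s Ps] Cs <-] /= sa].
      by apply: lt_le_trans (Ps _ sa) (rhoM _ _ (uC _ _)); exists (exist P s Ps).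
    by exists (exist P u Pu) => s Cs /=; apply: uC; exists s.
  by exists t => // s Ps ts; have := tmax (exist P s Ps) ts => -[].
pose x := rho t.
have te (g : R) a : t a -> (a < ((x, g) : R *l R))%O.
  by move=> /Pt ax; rewrite ltEprodlexi /= (ltW ax) leNgt ax.
pose s g := wotree_rcons (te g).
(* The shift [n.+1] is positive even at [n = 0], which puts the new point strictly above
   [(x, g)]. *)
have se (g : R) (n : nat) a : s g a -> (a < ((x, (g + n.+1%:R)%R) : R *l R))%O.
  move=> [/te//|->]; rewrite ltEprodlexi /= lexx /= ltrDl ltr0n //.
pose s' g n := wotree_rcons (se g n).
have ts g : (t <= s g)%O by exact/ltW/wotree_rcons_gt.
have ss' g n : (s g <= s' g n)%O by exact/ltW/wotree_rcons_gt.
have s'E g n : rho (s' g n) = rho t.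
  apply/eqP; rewrite eq_le (rhoM t) ?andbT; last exact: le_trans (ss' g n).
  (* All first coordinates in [s' g n] are at most [rho t]. If [rho] grew there, [P] would hold at
     [s' g n], and maximality would make this node equal to [t]. *)
  rewrite leNgt; apply/negP => lts'.
  have /tmax : P (s' g n).
    by move=> a [[/Pt /lt_trans -> //|->]|->].
  move=> /(_ (le_trans (ts g) (ss' g n))) s't; rewrite s't ltxx in lts'.
  by [].
exists t, s; split; first by apply: wotree_rcons_fan => g g' [].
move=> g; split.
  by apply/eqP; rewrite eq_le (rhoM t)// andbT -(s'E g 0%N) rhoM.
exists (s' g); split => //; apply: wotree_rcons_fan => n m [] /addrI/eqP.
by rewrite eqr_nat => /eqP[].
Qed.

End kurepa.

(** * Completion of a space of bounded functions *)

Section uniform_closure.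
Context {R : realType} {V : lmodType R} {I : Type}.
Variable phi : {linear V -> (I -> R^o)}.

(** The closure of the range of [phi] in the sup-normed space of bounded functions, which serves as
    a concrete completion. *)
Definition uclosure_pred : {pred I -> R^o} := [pred G : I -> R^o |
  `[< (exists M, forall i, `|G i| <= M) /\
      forall e, 0 < e -> exists v, forall i, `|G i - phi v i| <= e >]].

Record uclosure : Type :=
  UClosure { uclosure_fun :> I -> R^o ; _ : uclosure_fun \in uclosure_pred }.

HB.instance Definition _ := [isSub for uclosure_fun].
HB.instance Definition _ := [Choice of uclosure by <:].

Lemma uclosure_submod_closed : submod_closed uclosure_pred.
Proof.
split.
  apply/asboolP; split; first by exists 0 => i; rewrite normr0.
  by move=> e e0; exists 0 => i; rewrite raddf0 subrr normr0 ltW.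
move=> a f g /asboolP[[Mf fM] fa] /asboolP[[Mg gM] ga]; apply/asboolP; split.
  exists (`|a| * Mf + Mg) => i; apply: le_trans (ler_normD _ _) _.
  by rewrite lerD// normrZ ler_wpM2l.
move=> e e0; have [|v vP] := fa (e / 2 / (`|a| + 1)).
  by rewrite !divr_gt0// ltr_wpDl.
have [|w wP] := ga (e / 2); first by rewrite divr_gt0.
exists (a *: v + w) => i; rewrite linearP !fctE.
rewrite opprD addrACA -scalerBr [leRHS]splitr.
apply: le_trans (ler_normD _ _) _; rewrite lerD//.
rewrite normrZ; apply: le_trans (ler_wpM2l (normr_ge0 a) (vP i)) _.
rewrite mulrCA ler_piMr//; first by rewrite divr_ge0// ltW.
by rewrite ler_pdivrMr ?mul1r ?lerDl// ltr_wpDl.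
Qed.

HB.instance Definition _ :=
  GRing.isSubmodClosed.Build _ _ uclosure_pred uclosure_submod_closed.
HB.instance Definition _ := [SubChoice_isSubLmodule of uclosure by <:].

Lemma uclosureP (G : uclosure) : (exists M, forall i, `|G i| <= M) /\
  forall e, 0 < e -> exists v, forall i, `|G i - phi v i| <= e.
Proof. by case: G => G /= /asboolP. Qed.

(** The value 0 is added so that the supremum is taken over a nonempty set even when [I] is
    empty. *)
Let values (G : uclosure) := [set r : R | r = 0 \/ exists i, r = `|G i|].

Definition uclosure_norm (G : uclosure) : R := sup (values G).

Let values_has_sup G : has_sup (values G).
Proof.
split; first by exists 0; left.
have [[M GM] _] := uclosureP G; exists `|M| => _ [->//|[i ->]].
exact: le_trans (GM i) (ler_norm _).
Qed.

Lemma uclosure_norm_ub (G : uclosure) i : `|G i| <= uclosure_norm G.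
Proof. by apply: sup_upper_bound => //; right; exists i. Qed.

Lemma uclosure_norm_lub (G : uclosure) M :
  0 <= M -> (forall i, `|G i| <= M) -> uclosure_norm G <= M.
Proof.
move=> M0 GM; apply: ge_sup; first by exists 0; left.
by move=> _ [->//|[i ->]].
Qed.

Lemma uclosure_norm_ge0 (G : uclosure) : 0 <= uclosure_norm G.
Proof. by apply: sup_upper_bound => //; left. Qed.

Lemma uclosure_normD (f g : uclosure) :
  uclosure_norm (f + g) <= uclosure_norm f + uclosure_norm g.
Proof.
apply: uclosure_norm_lub => [|i]; first by rewrite addr_ge0 ?uclosure_norm_ge0.
by apply: le_trans (ler_normD _ _) _; apply: lerD; exact: uclosure_norm_ub.
Qed.

Lemma uclosure_normZ (a : R) (f : uclosure) :
  uclosure_norm (a *: f) = `|a| * uclosure_norm f.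
Proof.
have le_normZ b g : uclosure_norm (b *: g) <= `|b| * uclosure_norm g.
  apply: uclosure_norm_lub => [|i]; first by rewrite mulr_ge0 ?uclosure_norm_ge0.
  by rewrite [leLHS](normrM b) ler_wpM2l// uclosure_norm_ub.
apply/eqP; rewrite eq_le le_normZ /=.
have [->|a0] := eqVneq a 0; first by rewrite normr0 mul0r uclosure_norm_ge0.
rewrite -ler_pdivlMl ?normr_gt0// -normfV.
by rewrite -[in leLHS](scalerK a0 f).
Qed.

Lemma uclosure_norm0_eq0 (f : uclosure) : uclosure_norm f = 0 -> f = 0.
Proof.
move=> f0; apply/val_inj/funext => i /=; apply/eqP.
by rewrite -normr_le0 -f0 uclosure_norm_ub.
Qed.

HB.instance Definition _ := Lmodule_isNormed.Build R uclosure
  uclosure_normD uclosure_normZ uclosure_norm0_eq0.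

Lemma uclosure_ballE (f g : uclosure) e : ball f e g = (`|f - g| < e).
Proof. by rewrite -ball_normE. Qed.

(** Pointwise limits exist by completeness of [R]; the Cauchy estimates are uniform in the index and
    pass to the limit. *)
Lemma uclosure_complete (F : set_system uclosure) :
  ProperFilter F -> cauchy F -> cvg F.
Proof.
move=> FF /cauchyP Fc.
have evc i : cvg ((fun g : uclosure => g i : R) @ F).
  apply/cauchy_cvgP/cauchy_exP => e e0; have [f Ff] := Fc _ e0.
  exists (f i); change (F [set g | ball (f i : R) e (g i)]).
  apply: filterS Ff => g; rewrite uclosure_ballE /= -ball_normE /= => fg.
  apply: le_lt_trans fg.
  exact: (uclosure_norm_ub (f - g)).
pose L i : R^o := lim ((fun g : uclosure => g i : R) @ F).
have Lle e (f : uclosure) : F (ball f e) -> forall i, `|f i - L i| <= e.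
  move=> Ff i; rewrite distrC ler_distl; apply/andP; split.
    apply: (limr_ge (evc i)); apply: filterS Ff => g; rewrite uclosure_ballE => fg.
    rewrite lerBlDr -lerBlDl; apply: le_trans (ler_norm _) _.
    exact: le_trans (uclosure_norm_ub (f - g) i) (ltW fg).
  apply: (limr_le (evc i)); apply: filterS Ff => g; rewrite uclosure_ballE => fg.
  rewrite -lerBlDl; apply: le_trans (ler_norm _) _; rewrite distrC.
  exact: le_trans (uclosure_norm_ub (f - g) i) (ltW fg).
have LX : L \in uclosure_pred.
  apply/asboolP; split.
    have [f /Lle fL] := Fc _ ltr01; have [[M fM] _] := uclosureP f.
    exists (M + 1) => i; rewrite -[L i](subrK (f i)) addrC.
    by apply: le_trans (ler_normD _ _) _; rewrite lerD// distrC.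
  move=> e e0; have [|f /Lle fL] := Fc (e / 2); first by rewrite divr_gt0.
  have [_ /(_ (e / 2))] := uclosureP f; rewrite divr_gt0// => -[//|v vP].
  exists v => i; rewrite -[L i](subrK (f i)) -addrA [leRHS]splitr.
  by apply: le_trans (ler_normD _ _) _; rewrite lerD// distrC.
apply/cvg_ex; exists (UClosure LX); apply/cvg_ballP => e e0.
(* Two errors of [e / 4] add up to [e / 2], so the inequality is still strict after taking the
   supremum. *)
have [|f Ff] := Fc (e / 4); first by rewrite divr_gt0.
have fL := Lle _ _ Ff.
apply: filterS Ff => g; rewrite !uclosure_ballE => fg.
suff : uclosure_norm (UClosure LX - g) <= e / 2.
  by move=> /le_lt_trans; apply; rewrite ltr_pdivrMr// mulr_natr mulr2n ltrDl.
apply: uclosure_norm_lub => [|i]; first by rewrite divr_ge0// ltW.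
have tri (a b c : R) : `|a - c| <= e / 4 -> `|a - b| <= e / 4 -> `|b - c| <= e / 2.
  by rewrite !ler_norml => /andP[? ?] /andP[? ?]; apply/andP; split; lra.
apply: (tri (f i)); last exact: fL.
exact: le_trans (uclosure_norm_ub (f - g) i) (ltW fg).
Qed.

HB.instance Definition _ := Uniform_isComplete.Build uclosure uclosure_complete.

Hypothesis phi_bounded : forall v, exists M, forall i, `|phi v i| <= M.

Fact uclosure_in_subproof v : phi v \in uclosure_pred.
Proof.
by apply/asboolP; split => // e e0; exists v => i; rewrite subrr normr0 ltW.
Qed.

Definition uclosure_in (v : V) : uclosure := UClosure (uclosure_in_subproof v).

Fact uclosure_in_linear : linear uclosure_in.
Proof. by move=> a u v; apply/val_inj; rewrite /= linearP. Qed.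

HB.instance Definition _ := GRing.isLinear.Build _ _ _ _ _ uclosure_in_linear.

Lemma uclosure_in_dense : dense (range uclosure_in).
Proof.
move=> O [G OG] oO.
have /(nbhs_ballP G)[e /= e0 eO] : nbhs G O by exact: open_nbhs_nbhs.
have [_ /(_ (e / 2))] := uclosureP G; rewrite divr_gt0// => -[//|v vP].
exists (uclosure_in v); split; last by exists v.
apply: eO; rewrite uclosure_ballE.
apply: (@le_lt_trans _ _ (e / 2)); last first.
  by rewrite ltr_pdivrMr// mulr_natr mulr2n ltrDl.
by apply: uclosure_norm_lub => //; rewrite divr_ge0// ltW.
Qed.

End uniform_closure.

(** * The Cauchy-Schwarz inequality *)

Section cauchy_schwarz.
Context {R : realType}.

Lemma sum_mulr_le_sqrt n (a x : 'I_n -> R) :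
  `|\sum_i a i * x i| <= Num.sqrt (\sum_i a i ^+ 2) * Num.sqrt (\sum_i x i ^+ 2).
Proof.
set A := \sum_i a i ^+ 2; set X := \sum_i x i ^+ 2; set P := \sum_i a i * x i.
have A0 : 0 <= A by apply: sumr_ge0 => i _; exact: sqr_ge0.
have X0 : 0 <= X by apply: sumr_ge0 => i _; exact: sqr_ge0.
rewrite -sqrtrM// -sqrtr_sqr ler_sqrt ?mulr_ge0//.
have [XE|Xneq] := eqVneq X 0.
  have x0 i : x i = 0.
    apply/eqP; rewrite -sqrf_eq0; apply/eqP; move: i.
    move/eqP: XE; rewrite psumr_eq0 => [/allP xP i|i _]; last exact: sqr_ge0.
    by apply/eqP; apply: xP; rewrite mem_index_enum.
  by rewrite /P big1 ?expr0n ?mulr_ge0// => i _; rewrite x0 mulr0.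
have Xgt : 0 < X by rewrite lt_def Xneq.
(* This sum of squares expands to [X * (A * X - P ^+ 2)], and [X] is positive. *)
have : 0 <= \sum_i (X * a i - P * x i) ^+ 2.
  by apply: sumr_ge0 => i _; exact: sqr_ge0.
have -> : \sum_i (X * a i - P * x i) ^+ 2 = X * (A * X - P ^+ 2).
  transitivity (X ^+ 2 * A - 2 * X * P * P + P ^+ 2 * X); last by ring.
  have expand u v : \sum_i (u * a i - v * x i) ^+ 2 =
      u ^+ 2 * A - 2 * u * v * P + v ^+ 2 * X.
    rewrite /A /P /X !mulr_sumr -sumrN -!big_split /=.
    by apply: eq_bigr => i _; ring.
  exact: expand.
by rewrite pmulr_rge0// subr_ge0.
Qed.

End cauchy_schwarz.

(** * Norm estimates for bounded functionals *)

Section dual_facts.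
Context {R : realType} {V : normedModType R}.
Implicit Types f g : dual V.

Lemma bounded_linear_dual_pred (l : V -> R^o) M :
  linear l -> (forall x, `|l x| <= M * `|x|) -> l \in @dual_pred R V.
Proof.
move=> ll lM; apply/asboolP; split => //.
pose L : {linear V -> R^o} := HB.pack l (GRing.isLinear.Build _ _ _ _ _ ll).
apply: (@bounded_linear_continuous _ _ _ L); apply/linear_boundedP.
by near=> r => x; apply: le_trans (lM x) _; apply: ler_wpM2r.
Unshelve. all: by end_near. Qed.

Lemma dual_linear f : linear f. Proof. by have [] := dualP f. Qed.

Lemma dual_add f g x : (f + g) x = f x + g x. Proof. by []. Qed.

Lemma dual_scale a f x : (a *: f) x = a * f x. Proof. by []. Qed.

Lemma dual_sum (I : Type) (r : seq I) (F : I -> dual V) x :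
  (\sum_(i <- r) F i) x = \sum_(i <- r) F i x.
Proof.
elim: r => [|i r IHr]; first by rewrite !big_nil.
by rewrite !big_cons dual_add IHr.
Qed.

Lemma dual_apply0 f : f 0 = 0.
Proof.
have := dual_linear f 1 0 0; rewrite scaler0 addr0 => /(congr1 (fun z => z - f 0)).
by rewrite addrK subrr scale1r.
Qed.

Lemma dual_applyD f x y : f (x + y) = f x + f y.
Proof. by have := dual_linear f 1 x y; rewrite !scale1r. Qed.

Lemma dual_applyZ f a x : f (a *: x) = a * f x.
Proof. by have := dual_linear f a x 0; rewrite !addr0 dual_apply0 addr0. Qed.

Lemma dual_norm_le f x : `|f x| <= `|f| * `|x|.
Proof.
have [->|x0] := eqVneq x 0; first by rewrite dual_apply0 normr0 mulr_ge0.
have nx : 0 < `|x| by rewrite normr_gt0.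
rewrite -ler_pdivrMr// mulrC -[X in X * _](gtr0_norm) ?invr_gt0// -normrM.
rewrite -dual_applyZ; apply: dual_norm_ub.
by rewrite normrZ normfV normr_id mulVf// gt_eqF.
Qed.

Lemma dual_norm_dense (D : set V) f M : dense D -> 0 <= M ->
  (forall x, D x -> `|f x| <= M * `|x|) -> `|f| <= M.
Proof.
move=> dD M0 fM; apply: dual_norm_lub => x x1; apply/ler_addgt0Pl => e e0.
have K0 : 0 < `|f| + M + 1 by rewrite ltr_wpDl// addr_ge0.
(* Replacing [x] by a point of [D] within [eta] costs at most [|f| * eta + M * eta], which is below
   [e]; the added 1 keeps the denominator positive. *)
set eta := e / (`|f| + M + 1); have eta0 : 0 < eta by rewrite divr_gt0.
have [|y [/= xy Dy]] := dD (ball x eta) _ (ball_open _ _).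
  by exists x; exact: ballxx.
move: xy; rewrite -ball_normE /= => /ltW xy.
have yn : `|y| <= 1 + eta.
  rewrite -[y](subrK x); apply: le_trans (ler_normD _ _) _.
  by rewrite addrC lerD// distrC.
have fy : `|f y| <= M * (1 + eta).
  by apply: le_trans (fM _ Dy) _; exact: ler_wpM2l.
have fxy : `|f (x - y)| <= `|f| * eta.
  by apply: le_trans (dual_norm_le _ _) _; exact: ler_wpM2l.
have -> : f x = f (x - y) + f y by rewrite -dual_applyD subrK.
apply: le_trans (ler_normD _ _) _; apply: le_trans (lerD fxy fy) _.
have etaE : eta * (`|f| + M + 1) = e by rewrite divfK ?gt_eqF.
lra.
Qed.

Lemma dual_eq_dense (D : set V) f g : dense D ->
  (forall x, D x -> f x = g x) -> f = g.
Proof.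
move=> dD fg; apply/eqP; rewrite -subr_eq0 -normr_le0.
apply: (dual_norm_dense dD) => // x Dx; rewrite mul0r.
by rewrite dual_add -[(- g) x]/(- g x) fg// subrr normr0.
Qed.

End dual_facts.

(** * The James tree space and the functionals of its segments *)

Section segment_sums.
Context {R : realType} d {T : porderType d}.
Implicit Types (f : c00 R T) (s : set T).

Lemma c00_support f : exists2 F : seq T, uniq F & forall t, f t <> 0 -> t \in F.
Proof.
have [F FE] : exists F : seq T, [set t | f t <> 0] = [set` F].
  by apply/finite_seqP; case: f => f /= /asboolP.
exists (undup F); first exact: undup_uniq.
by move=> t ft; rewrite mem_undup; have : [set` F] t by rewrite -FE.
Qed.

Definition seg_sum s f : R := \sum_(t \in s) f t.

(** Moves the dependence on [s] into an indicator, so that sums along different segments share one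
    finite index list. *)
Lemma seg_sumE s f (F : seq T) : uniq F -> (forall t, f t <> 0 -> t \in F) ->
  seg_sum s f = \sum_(t <- F) \1_s t * f t.
Proof.
move=> uF Ff; have f0 t : t \notin F -> f t = 0.
  by move=> tF; apply: contrapT => /Ff; rewrite (negbTE tF).
transitivity (\sum_(t \in [set` F] ) \1_s t * f t : R); last by rewrite -fsbig_seq.
rewrite /seg_sum fsbig_mkcond [RHS]fsbig_mkcond.
apply: eq_fsbigr => t _; rewrite /patch indicE.
have -> : (t \in [set` F]) = (t \in F).
  by apply/idP/idP => [/set_mem|?]; [|exact: mem_set].
have [tF|tF] := boolP (t \in F); last by rewrite f0//; case: ifP.
by case: (t \in s); rewrite ?mul1r ?mul0r.
Qed.

Fact seg_sum_linear s : linear (seg_sum s : _ -> R^o).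
Proof.
move=> a f g; have [F uF Ff] := c00_support f; have [G uG Gg] := c00_support g.
pose H := undup (F ++ G).
have fH t : f t <> 0 -> t \in H by move=> /Ff; rewrite mem_undup mem_cat => ->.
have gH t : g t <> 0 -> t \in H.
  by move=> /Gg; rewrite mem_undup mem_cat orbC => ->.
have uH : uniq H by exact: undup_uniq.
rewrite !(seg_sumE _ uH)//; last first.
  move=> t; change ((a *: f + g) t) with (a * f t + g t) => fgt.
  have [f0|/eqP/fH//] := eqVneq (f t) 0; apply: gH => g0; apply: fgt.
  by rewrite f0 g0 mulr0 addr0.
rewrite scaler_sumr -big_split /=; apply: eq_bigr => t _.
change ((a *: f + g) t) with (a * f t + g t); rewrite mulrDr mulrCA //.
Qed.

HB.instance Definition _ s :=
  GRing.isLinear.Build _ _ _ _ (seg_sum s : _ -> R^o) (seg_sum_linear s).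

Lemma sum_indic_trivIset n (s : 'I_n -> set T) t :
  trivIset setT s -> \sum_(i < n) \1_(s i) t <= 1 :> R.
Proof.
move=> tr; have [[i0 si0]|ns] := pselect (exists i, s i t); last first.
  rewrite big1 ?ler01// => i _; rewrite indicE memNset// => sit.
  by apply: ns; exists i.
rewrite (bigD1 i0)//= big1 ?addr0 => [|i ii0]; first by rewrite indicE mem_set.
rewrite indicE memNset// => sit; move/eqP: ii0; apply.
by apply: tr => //; exists t.
Qed.

(** By duality in the Euclidean norm, the James tree norm is a supremum of linear functionals, one
    for each disjoint family of segments and each coefficient vector in the unit ball. Hence
    [jt_eval] is isometric into bounded functions on these indices. *)
Record jt_index : Type := JTIndex {
  jt_size : nat;
  jt_seg : 'I_jt_size -> set T;
  jt_coef : 'I_jt_size -> R;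
  jt_segP : forall i, segment (jt_seg i);
  jt_trivIset : trivIset setT jt_seg;
  jt_coefP : \sum_i jt_coef i ^+ 2 <= 1 }.

Definition jt_eval f (x : jt_index) : R^o :=
  \sum_i @jt_coef x i * seg_sum (@jt_seg x i) f.

Fact jt_eval_linear : linear jt_eval.
Proof.
move=> a f g; apply/funext => x; rewrite /jt_eval !fctE.
rewrite scaler_sumr -big_split /=; apply: eq_bigr => i _.
by rewrite linearP mulrDr mulrCA.
Qed.

HB.instance Definition _ :=
  GRing.isLinear.Build _ _ _ _ jt_eval jt_eval_linear.

Lemma jt_eval_bounded f : exists M, forall x, `|jt_eval f x| <= M.
Proof.
have [F uF Ff] := c00_support f; exists (\sum_(t <- F) `|f t|) => x.
have coef1 i : `|@jt_coef x i| <= 1.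
  rewrite -sqrtr_sqr -(sqrtr1 R) ler_sqrt//; apply: le_trans (jt_coefP x).
  by rewrite (bigD1 i)//= lerDl; apply: sumr_ge0 => j _; exact: sqr_ge0.
apply: (@le_trans _ _ (\sum_i \sum_(t <- F) \1_(@jt_seg x i) t * `|f t|)).
  apply: le_trans (ler_norm_sum _ _ _) _; apply: ler_sum => i _.
  rewrite normrM -[leRHS]mul1r; apply: ler_pM => //.
  rewrite (seg_sumE _ uF Ff); apply: le_trans (ler_norm_sum _ _ _) _.
  by apply: ler_sum => t _; rewrite normrM indicE normr_nat.
rewrite exchange_big /=; apply: ler_sum => t _.
rewrite -mulr_suml -[leRHS]mul1r; apply: ler_wpM2r => //.
exact: sum_indic_trivIset (@jt_trivIset x).
Qed.

Definition jt_embedding : {linear c00 R T -> (jt_index -> R^o)} := jt_eval.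

Definition james_tree_space := uclosure jt_embedding.

End segment_sums.

Section james_tree_functionals.
Context {R : realType} d {T : porderType d}.
Implicit Types (f : c00 R T) (s : set T).

Local Notation JT := (@james_tree_space R d T).

Definition jt_in : {linear c00 R T -> JT} := @uclosure_in _ _ _ (@jt_embedding R d T) (@jt_eval_bounded R d T).

Lemma jt_in_dense : dense (range jt_in).
Proof. exact: uclosure_in_dense. Qed.

Let jt_values f := [set r | exists n (s : 'I_n -> set T),
    [/\ forall i, segment (s i), trivIset setT s &
        r = Num.sqrt (\sum_(i < n) (\sum_(t \in s i) f t) ^+ 2)]].

Lemma jt_values_le f : ubound (jt_values f) `|jt_in f|.
Proof.
move=> _ [n [s [ss ts ->]]]; pose x i := seg_sum (s i) f.
change (Num.sqrt (\sum_i x i ^+ 2) <= `|jt_in f|).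
set r := Num.sqrt _; have [->//|r0] := eqVneq r 0.
have rgt : 0 < r by rewrite lt_def r0 sqrtr_ge0.
have rE : r ^+ 2 = \sum_i x i ^+ 2.
  by rewrite sqr_sqrtr//; apply: sumr_ge0 => i _; exact: sqr_ge0.
(* The normalized vector [x i / r] gives equality in Cauchy-Schwarz. *)
have a1 : \sum_i (x i / r) ^+ 2 <= 1.
  under eq_bigr do rewrite exprMn.
  by rewrite -mulr_suml -rE exprVn divff// expf_neq0.
apply: le_trans (uclosure_norm_ub (jt_in f) (JTIndex ss ts a1)).
rewrite [X in `|X|]/= /jt_eval /= (_ : \sum_i _ = r) ?ler_norm//.
transitivity ((\sum_i x i ^+ 2) / r); last by rewrite -rE expr2 mulfK.
by rewrite mulr_suml; apply: eq_bigr => i _; rewrite mulrAC.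
Qed.

Lemma jt_values_has_sup f : has_sup (jt_values f).
Proof.
split; last by exists `|jt_in f|; exact: jt_values_le.
exists 0, 0%N, (fun=> set0); split; [by case|by move=> []|].
by rewrite big_ord0 sqrtr0.
Qed.

Lemma jt_in_norm f : `|jt_in f| = james_tree_norm f.
Proof.
have ub r : jt_values f r -> r <= james_tree_norm f.
  exact: (sup_upper_bound (jt_values_has_sup f)).
apply/eqP; rewrite eq_le; apply/andP; split; last first.
  apply: ge_sup; last exact: jt_values_le.
  by have [] := jt_values_has_sup f.
apply: uclosure_norm_lub => [|x].
  apply: ub; exists 0%N, (fun=> set0); split; [by case|by move=> []|].
  by rewrite big_ord0 sqrtr0.
apply: le_trans (ub _ _); last first.
  by exists (jt_size x), (@jt_seg _ _ _ x); split; [exact: jt_segP|exact: jt_trivIset|].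
apply: le_trans (sum_mulr_le_sqrt _ _) _; rewrite -[leRHS]mul1r.
apply: ler_wpM2r; first exact: sqrtr_ge0.
by rewrite -(sqrtr1 R) ler_sqrt//; exact: jt_coefP.
Qed.

Lemma james_tree_spaceP : is_james_tree_space T JT.
Proof. by exists jt_in; split; [exact: jt_in_norm|exact: jt_in_dense]. Qed.

Lemma seg_sums_le_norm f n (s : 'I_n -> set T) :
  (forall i, segment (s i)) -> trivIset setT s ->
  Num.sqrt (\sum_i seg_sum (s i) f ^+ 2) <= `|jt_in f|.
Proof. by move=> ss ts; apply: jt_values_le; exists n, s. Qed.

Fact seg_index_triv (s : set T) : trivIset [set: 'I_1] (fun=> s).
Proof. by move=> i j _ _ _; rewrite !ord1. Qed.

Fact seg_index_coef : \sum_(i < 1) (1 : R) ^+ 2 <= 1.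
Proof. by rewrite big_ord1 expr1n. Qed.

(** Elements of the completion are functions on [jt_index], so summation along [s] extends to all of
    [JT] as evaluation at this index. *)
Definition seg_index s (ss : segment s) : @jt_index R d T :=
  JTIndex (fun=> ss) (@seg_index_triv s) seg_index_coef.

Fact seg_fun_subproof s (ss : segment s) :
  (fun x : JT => x (seg_index ss)) \in @dual_pred R JT.
Proof.
by apply: (@bounded_linear_dual_pred _ _ _ 1) => // x; rewrite mul1r uclosure_norm_ub.
Qed.

(* [0] when [s] is not a segment. *)
Definition seg_fun s : dual JT :=
  if pselect (segment s) is left ss then Dual (seg_fun_subproof ss) else 0.

Lemma seg_fun_in s f : segment s -> seg_fun s (jt_in f) = seg_sum s f.
Proof.
move=> ss; rewrite /seg_fun; case: pselect => // ss'.
by rewrite /= /jt_eval big_ord1 mul1r.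
Qed.

Lemma seg_fun_setU (s s1 s2 : set T) :
  segment s -> segment s1 -> segment s2 -> s = s1 `|` s2 -> s1 `&` s2 = set0 ->
  seg_fun s = seg_fun s1 + seg_fun s2.
Proof.
move=> ss ss1 ss2 sE dis; apply: (dual_eq_dense jt_in_dense) => _ [f _ <-].
rewrite dual_add !seg_fun_in//; have [F uF Ff] := c00_support f.
rewrite !(seg_sumE _ uF Ff) -big_split /=; apply: eq_bigr => t _.
rewrite -mulrDl; congr (_ * _); rewrite sE !indicE.
have : ~~ ((t \in s1) && (t \in s2)) by rewrite -in_setI dis in_set0.
by rewrite in_setU; case: (t \in s1); case: (t \in s2); rewrite // ?addr0 ?add0r.
Qed.

(** The upper 2-estimate for disjoint segments: on the dense image of [c00] it is Cauchy-Schwarz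
    followed by the definition of the James tree norm. *)
Lemma seg_fun_sum_norm n (s : 'I_n -> set T) (a : 'I_n -> R) :
  (forall i, segment (s i)) -> trivIset setT s ->
  `|\sum_i a i *: seg_fun (s i)| <= Num.sqrt (\sum_i a i ^+ 2).
Proof.
move=> ss ts; apply: (dual_norm_dense jt_in_dense) => [|_ [f _ <-]].
  exact: sqrtr_ge0.
rewrite dual_sum; under eq_bigr do rewrite dual_scale seg_fun_in//.
apply: le_trans (sum_mulr_le_sqrt _ _) _.
by apply: ler_wpM2l; [exact: sqrtr_ge0|exact: seg_sums_le_norm].
Qed.

Fact c00_delta_subproof t : (fun u => (u == t)%:R : R^o) \in @c00_pred R T.
Proof.
apply/asboolP; apply: sub_finite_set (finite_set1 t) => u /=.
by have [->//|_] := eqVneq u t.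
Qed.

Definition c00_delta t : c00 R T := C00 (c00_delta_subproof t).

Lemma seg_sum_delta s t : seg_sum s (c00_delta t) = \1_s t.
Proof.
rewrite (@seg_sumE _ _ _ _ _ [:: t])//; first by rewrite big_seq1 /= eqxx mulr1.
by move=> u /=; rewrite inE; have [//|] := eqVneq u t.
Qed.

Lemma c00_sum (I : Type) (r : seq I) (F : I -> c00 R T) u :
  (\sum_(i <- r) F i) u = \sum_(i <- r) F i u.
Proof.
elim: r => [|i r IHr]; first by rewrite !big_nil.
by rewrite !big_cons -IHr.
Qed.

Lemma c00_sum_delta f (F : seq T) : uniq F -> (forall t, f t <> 0 -> t \in F) ->
  f = \sum_(t <- F) (f t : R) *: c00_delta t.
Proof.
move=> uF Ff; apply/val_inj/funext => u /=; rewrite c00_sum.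
have deltaE t : ((f t : R) *: c00_delta t) u = f t * (u == t)%:R by [].
under eq_bigr do rewrite deltaE.
have [uF'|uF'] := boolP (u \in F); last first.
  have -> : f u = 0 by apply: contrapT => /Ff; rewrite (negbTE uF').
  rewrite big_seq big1// => t tF; have [ut|] := eqVneq u t; last by rewrite mulr0.
  by rewrite ut tF in uF'.
rewrite (bigD1_seq u)//= eqxx mulr1 big1 ?addr0// => t tu.
by rewrite eq_sym (negbTE tu) mulr0.
Qed.

Lemma jt_in_norm_le f M :
  (forall n (s : 'I_n -> set T), (forall i, segment (s i)) -> trivIset setT s ->
    \sum_i seg_sum (s i) f ^+ 2 <= M) -> `|jt_in f| <= Num.sqrt M.
Proof.
move=> fM; rewrite jt_in_norm; apply: ge_sup.
  by have [] := jt_values_has_sup f.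
by move=> _ [n [s [ss ts ->]]]; apply: ler_wsqrtr; exact: fM.
Qed.

(** A segment meets an antichain at most once, so each segment sum is at most 1 and dominates its
    square; disjoint segments together count each point of [F] at most once. *)
Lemma jt_in_antichain_norm (F : seq T) : uniq F ->
  {in F &, forall t u, (t <= u)%O -> t = u} ->
  `|jt_in (\sum_(t <- F) c00_delta t)| <= Num.sqrt (size F)%:R.
Proof.
move=> uF aF; apply: jt_in_norm_le => n s ss ts.
have sumE i : seg_sum (s i) (\sum_(t <- F) c00_delta t) = \sum_(t <- F) \1_(s i) t.
  by rewrite linear_sum; apply: eq_bigr => t _; exact: seg_sum_delta.
have sum_ge0 i : 0 <= \sum_(t <- F) \1_(s i) t :> R.
  by apply: sumr_ge0 => t _; rewrite indicE.
have sum_le1 i : \sum_(t <- F) \1_(s i) t <= 1 :> R.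
  have [[t [tF sit]]|nt] := pselect (exists t, t \in F /\ s i t); last first.
    rewrite big_seq big1 ?ler01// => t tF; rewrite indicE memNset// => sit.
    by apply: nt; exists t.
  rewrite (bigD1_seq t)//= big_seq_cond big1 ?addr0 ?indicE ?mem_set//.
  move=> u /andP[uF' /eqP ut]; rewrite indicE memNset// => siu; apply: ut.
  by have [/aF|/aF] := (ss i).1 _ _ siu sit; [apply|move=> /(_ tF uF')].
apply: (@le_trans _ _ (\sum_i \sum_(t <- F) \1_(s i) t)).
  apply: ler_sum => i _; rewrite sumE expr2 -[leRHS]mulr1.
  by apply: ler_wpM2l.
rewrite exchange_big /= -sum1_size natr_sum; apply: ler_sum => t _.
exact: sum_indic_trivIset.
Qed.

Lemma seg_fun_norm_ge1 s t : segment s -> s t -> 1 <= `|seg_fun s|.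
Proof.
move=> ss st; have d1 : `|jt_in (c00_delta t)| <= 1.
  have := @jt_in_antichain_norm [:: t]; rewrite big_seq1 /= sqrtr1; apply => //.
  by move=> u v; rewrite !inE => /eqP-> /eqP->.
have := dual_norm_le (seg_fun s) (jt_in (c00_delta t)).
rewrite seg_fun_in// seg_sum_delta indicE mem_set// normr1 => /le_trans; apply.
by rewrite -[leRHS]mulr1 ler_wpM2l.
Qed.

End james_tree_functionals.

(** * Weak-star compactness and countable supports *)

Section tree_countability.
Context d {T : porderType d}.
Hypothesis treeT : is_tree T.

Lemma tree_total (s t u : T) : (s <= u)%O -> (t <= u)%O ->
  (s <= t)%O \/ (t <= s)%O.
Proof.
rewrite le_eqVlt => /orP[/eqP<-|su]; first by right.
rewrite le_eqVlt => /orP[/eqP->|tu]; first by left; exact: ltW.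
exact/orP/(wochoice.wo_chainW (@treeT u) su tu).
Qed.

(** Every point of [S] is comparable to a member of an antichain [F] of maximal size. The points
    below a given [a] in [F] form a chain, and so do the points of [S] above [a]: two incomparable
    ones could replace [a] and enlarge [F]. *)
Lemma bounded_antichains_countable (S : set T) (K : nat) :
  (forall C : set T, total_on C (fun x y => (x <= y)%O) -> countable C) ->
  (forall F : seq T, uniq F -> {in F &, forall t u, (t <= u)%O -> t = u} ->
    (forall t, t \in F -> S t) -> (size F <= K)%N) ->
  countable S.
Proof.
move=> chainC antiK; pose anti (F : seq T) :=
  [/\ uniq F, {in F &, forall t u, (t <= u)%O -> t = u} & forall t, t \in F -> S t].
have [F [[uF aF FS] Fmax]] : exists F, anti F /\ forall G, anti G -> (size G <= size F)%N.
  pose P n := `[< exists2 F, anti F & size F = n >].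
  have P0 : exists n, P n by exists 0%N; apply/asboolP; exists [::].
  have PK n : P n -> (n <= K)%N by move=> /asboolP[F [uF aF FS] <-]; exact: antiK.
  case: (ex_maxnP P0 PK) => _ /asboolP[F aF <-] Fmax; exists F; split => // G aG.
  by apply: Fmax; apply/asboolP; exists G.
have cover : S `<=` \bigcup_(a in [set` F])
    ([set t | (t <= a)%O] `|` [set t | S t /\ (a <= t)%O]).
  move=> t St; apply: contrapT => nt.
  have ntF a : a \in F -> ~ (t <= a)%O /\ ~ (a <= t)%O.
    by move=> aF'; split => ?; apply: nt; exists a => //; [left|right].
  have /Fmax : anti (t :: F).
    split => /=.
    - rewrite uF andbT; apply/negP => tF.
      by have [] := ntF _ tF; rewrite lexx.
    - move=> x y; rewrite !inE => /orP[/eqP->|xF] /orP[/eqP->|yF] //.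
      + by have [? _] := ntF _ yF.
      + by have [_ ?] := ntF _ xF.
      + exact: aF.
    - by move=> x; rewrite inE => /orP[/eqP->|/FS].
  by rewrite /= ltnn.
apply: sub_countable (subset_card_le cover) _.
apply: bigcup_countable => [|a /= aF']; first exact/finite_set_countable/finite_seq.
rewrite -bigcup2E; apply: bigcup_countable => // -[_|[_|n _]] /=.
- by apply: chainC => s t; exact: tree_total.
- apply: chainC => s t /= [Ss as_] [St at_].
  apply: contrapT => nst; have nstl : ~ (s <= t)%O by move=> ?; apply: nst; left.
  have nstr : ~ (t <= s)%O by move=> ?; apply: nst; right.
  have ntF b : b \in rem a F -> b \in F /\ b <> a.
    by rewrite mem_rem_uniq// !inE => /andP[/eqP].
  (* A point above [a] and comparable to [b] would make [a] and [b] comparable, as predecessors in a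
     tree form chains. *)
  have cmp b x : (a <= x)%O -> b \in rem a F -> ~ (x <= b)%O /\ ~ (b <= x)%O.
    move=> ax /ntF[bF ba]; split => [xb|bx].
      by apply: ba; rewrite (aF a b)//; exact: le_trans xb.
    by have [/aF|/aF] := tree_total ax bx => [/(_ aF' bF)|/(_ bF aF')]; [move=> /esym|].
  have /Fmax : anti [:: s, t & rem a F].
    split => /=.
    - rewrite rem_uniq// inE !negb_or andbT; apply/andP; split; [apply/andP; split|].
      + by apply/eqP => st; apply: nstl; rewrite st.
      + by apply/negP => /(cmp _ _ as_)[]; rewrite lexx.
      + by apply/negP => /(cmp _ _ at_)[]; rewrite lexx.
    - move=> x y; rewrite !inE => /or3P[/eqP->|/eqP->|xF] /or3P[/eqP->|/eqP->|yF] //.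
      + by have [? _] := cmp _ _ as_ yF.
      + by have [? _] := cmp _ _ at_ yF.
      + by have [_ ?] := cmp _ _ as_ xF.
      + by have [_ ?] := cmp _ _ at_ xF.
      + by apply: aF; [have [] := ntF _ xF|have [] := ntF _ yF].
    - by move=> x; rewrite !inE => /or3P[/eqP->|/eqP->|/ntF[/FS]].
  by rewrite /= size_rem// prednK ?ltnn//; case: (F) aF'.
- exact: countable0.
Qed.

End tree_countability.

Section compact_inverse.
Context {S U : topologicalType}.

Lemma homeomorphic_compact_image (A : set S) (f : S -> U) :
  A !=set0 -> compact A -> hausdorff_space U -> continuous f ->
  {in A &, injective f} -> homeomorphic_sets A (f @` A).
Proof.
move=> [x0 Ax0] cA hU cf injf.
(* [homeomorphic_sets] asks for a total inverse, so [g] takes the default value [x0] off the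
   image. *)
pose g y := xget x0 [set x | A x /\ f x = y].
have gP y : (f @` A) y -> A (g y) /\ f (g y) = y.
  move=> [x Ax fx]; rewrite /g; case: xgetP => [z -> //|/(_ x)[]]; by split.
have gK x : A x -> g (f x) = x.
  move=> Ax; have [Ag fg] := gP (f x) (ex_intro2 _ _ x Ax erefl).
  by apply: injf => //; exact: mem_set.
exists f, g; split => //.
- exact: continuous_subspaceT.
- apply/continuous_closedP => C cC; apply/closed_subspaceP.
  (* The preimage of [C] under [g] is traced by the image of a compact set, which is closed as [U]
     is Hausdorff. *)
  exists (f @` (A `&` C)).
    apply: compact_closed => //; apply: continuous_compact.
      exact: continuous_subspaceT.
    exact: compact_closedI.
  apply/seteqP; split => [y [[x [Ax Cx] <-] fAx]|y [Cgy /[dup] fAy /gP[Agy gyE]]].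
    by split; [change (C (g (f x))); rewrite gK|exists x].
  by split => //; exists (g y).
- by apply/seteqP; split => [_ [y /gP[? _] <-]//|x Ax]; exists (f x); [exists x|exact: gK].
- by move=> x /set_mem; exact: gK.
Qed.

End compact_inverse.

Section pointwise_convergence.
Context {I : eqType} {K : topologicalType}.

Lemma cvg_ptws (F : set_system (I -> K)) (f : I -> K) : Filter F ->
  (forall i, (fun g => g i) @ F --> f i) -> F --> (f : {ptws I -> K}).
Proof.
move=> FF Ff; apply/cvg_sup => i A [_ [[B oB <-] Bf] BA].
by apply: filterS BA _; apply: (Ff i B); exact: open_nbhs_nbhs.
Qed.

Lemma ptws_eval_continuous i : continuous ((fun g => g i) : {ptws I -> K} -> K).
Proof. exact: (@proj_continuous I (fun=> K) i). Qed.

End pointwise_convergence.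

(** * The Banach-Alaoglu theorem *)

Section banach_alaoglu.
Context {R : realType} {V : normedModType R}.

Lemma weak_star_eval_continuous (x : V) :
  continuous ((fun f => dual_fun f x) : weak_star V -> R).
Proof.
move=> f; apply: (@continuous_comp _ _ _
  ((fun f => dual_fun f) : weak_star V -> {ptws V -> R}) (fun g => g x)).
  exact: initial_continuous.
exact: ptws_eval_continuous.
Qed.

(** As a set of functions, the ball is the closed set of linear maps inside a product of compact
    intervals. *)
Lemma dual_ball_compact : compact (@dual_ball R V).
Proof.
pose ev := (fun f => dual_fun f) : weak_star V -> {ptws V -> R}.
pose box := [set p : {ptws V -> R} | forall x, `[- `|x|, `|x|]%classic (p x)].
have cbox : compact box.
  apply: (@tychonoff V (fun=> R) (fun x => `[- `|x|, `|x|]%classic)) => x.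
  exact: segment_compact.
pose lin := [set p : {ptws V -> R} | forall a x y, p (a *: x + y) = a * p x + p y].
have clin : closed lin.
  have -> : lin = \bigcap_(u in [set: R * V * V])
      ((fun p : {ptws V -> R} =>
        p (u.1.1 *: u.1.2 + u.2) - (u.1.1 * p u.1.2 + p u.2)) @^-1` [set 0]).
    apply/seteqP; split => [p plin [[a x] y] _ /=|p pu a x y].
      by rewrite plin subrr.
    by have /eqP := pu (a, x, y) I; rewrite /= subr_eq0 => /eqP.
  apply: closed_bigI => -[[a x] y] _; apply: preimage_closed; last exact: closed_eq.
  have cev u (p : {ptws V -> R}) := @ptws_eval_continuous V R u p.
  by move=> p _; exact: cvgB (cev _ p) (cvgD (cvgMr (cev _ p)) (cev _ p)).
have evE : ev @` @dual_ball R V = box `&` lin.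
  apply/seteqP; split => [_ [f /= f1 <-]|p [pbox plin]].
    split => [x|a x y]; last by rewrite /ev dual_applyD dual_applyZ.
    rewrite /= in_itv /= -ler_norml; apply: le_trans (dual_norm_le _ _) _.
    by rewrite -[leRHS]mul1r ler_wpM2r.
  have pd : (p : V -> R^o) \in @dual_pred R V.
    apply: (@bounded_linear_dual_pred _ _ _ 1) => // x; rewrite mul1r ler_norml.
    by have := pbox x; rewrite /= in_itv.
  exists (Dual pd) => //; apply: dual_norm_lub => x x1; apply: le_trans x1.
  by rewrite ler_norml; have := pbox x; rewrite /= in_itv.
have cev : compact (ev @` @dual_ball R V).
  by rewrite evE; exact: compact_closedI.
(* The weak-star topology is the initial one for [ev], so a cluster point of the image filter lifts
   to a cluster point of [F]. *)
move=> F FF FA.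
have [|p [[f Af fp] pF]] := cev (ev @ F).
  change (F (ev @^-1` (ev @` @dual_ball R V))).
  by apply: filterS FA => f Af; exists f.
exists f; split => // B C FB; rewrite nbhsE => -[D [[W oW <-] /= Wf] DC].
have [||_ [[g Bg <-] Wg]] := pF (ev @` B) W.
- change (F (ev @^-1` (ev @` B))).
  by apply: filterS FB => g Bg; exists g.
- by apply: open_nbhs_nbhs; split => //; rewrite -fp.
by exists g; split => //; exact: DC.
Qed.

End banach_alaoglu.

(** * The dual ball of the James tree space is Corson compact *)

Section james_tree_determined.
Context {R : realType} d {T : porderType d}.
Hypothesis treeT : is_tree T.
Hypothesis chainT : forall C : set T, total_on C (fun x y => (x <= y)%O) -> countable C.

Local Notation JT := (@james_tree_space R d T).

Definition coord (x : dual JT) (t : T) : R := x (jt_in (c00_delta t)).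

(** Summing [x] over an antichain of [n] such points gives at least [n * e], but at most [|x|] times
    the square root of [n]; hence [n] is at most the square of [|x| / e]. *)
Lemma coord_gt_countable (x : dual JT) (e : R) : 0 < e ->
  countable [set t | e < coord x t].
Proof.
move=> e0; pose K := Num.bound ((`|x| / e) ^+ 2).
apply: (bounded_antichains_countable treeT chainT (K := K)) => F uF aF FS.
have [->//|F0] := eqVneq (size F) 0%N.
set m : R := Num.sqrt (size F)%:R; have m0 : 0 < m by rewrite sqrtr_gt0 ltr0n lt0n.
have mE : m ^+ 2 = (size F)%:R by rewrite sqr_sqrtr.
have : (size F)%:R * e <= `|x| * m.
  apply: le_trans (_ : x (jt_in (\sum_(t <- F) c00_delta t)) <= _).
    have [lx _] := dualP x.
    have -> : x (jt_in (\sum_(t <- F) c00_delta t)) = \sum_(t <- F) coord x t.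
      elim: (F) => [|t G IHG].
        by rewrite !big_nil raddf0 dual_apply0.
      by rewrite !big_cons raddfD dual_applyD IHG.
    rewrite -sum1_size natr_sum mulr_suml big_seq [leRHS]big_seq.
    by apply: ler_sum => t /FS /ltW; rewrite mul1r.
  apply: le_trans (ler_norm _) _; apply: le_trans (dual_norm_le _ _) _.
  by rewrite ler_wpM2l// jt_in_antichain_norm.
rewrite -mE expr2 mulrAC ler_pM2r// -ler_pdivlMr// => mx.
have xe0 : 0 <= `|x| / e by rewrite divr_ge0// ltW.
rewrite -(ler_nat R) -mE; apply: le_trans (_ : (`|x| / e) ^+ 2 <= _).
  by rewrite ler_sqr ?nnegrE// ltW.
by apply/ltW/archi_boundP; exact: sqr_ge0.
Qed.

Lemma coord_support_countable (x : dual JT) : countable [set t | coord x t <> 0].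
Proof.
have sub : [set t | coord x t <> 0] `<=` \bigcup_(n in [set: nat])
    ([set t | n.+1%:R^-1 < coord x t] `|` [set t | n.+1%:R^-1 < coord (- x) t]).
  move=> t /eqP xt; have xt0 : 0 < `|coord x t| by rewrite normr_gt0.
  have [n _ nx] := near_infty_natSinv_lt (PosNum xt0).
  exists n => //; have := nx n (leqnn n); rewrite /= ltr_normr => /orP[|]; first by left.
  by right.
apply: sub_countable (subset_card_le sub) _.
apply: bigcup_countable => // n _.
have cn y : countable [set t | n.+1%:R^-1 < coord y t].
  by apply: coord_gt_countable; rewrite invr_gt0.
rewrite -bigcup2E; apply: bigcup_countable => // -[_|[_|m _]]; [exact: cn..|].
exact: countable0.
Qed.

Lemma coord_inj : injective coord.
Proof.
move=> x y xy; apply: (dual_eq_dense (@jt_in_dense R d T)) => _ [f _ <-].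
have [F uF Ff] := c00_support f; rewrite (c00_sum_delta uF Ff).
elim: F {uF Ff} => [|t F IHF]; first by rewrite big_nil raddf0 !dual_apply0.
rewrite big_cons linearD linearZ !dual_applyD IHF !dual_applyZ.
by have := congr1 (fun c => c t) xy; rewrite /coord => ->.
Qed.

Lemma james_tree_space_wld : weakly_Lindelof_determined JT.
Proof.
pose F : weak_star JT -> {ptws T -> R} := coord.
have cF : continuous F.
  move=> x; have FF : Filter (F @ nbhs (x : weak_star JT)).
    exact: fmap_filter.
  apply: (@cvg_ptws _ _ _ _ FF) => t.
  exact: weak_star_eval_continuous.
exists T, (F @` @dual_ball R JT); split.
- by apply: continuous_compact; [exact: continuous_subspaceT|exact: dual_ball_compact].
- by move=> _ [x _ <-]; exact: coord_support_countable.
- apply: homeomorphic_compact_image => //.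
  + by exists (0 : dual JT); rewrite /dual_ball /= normr0.
  + exact: dual_ball_compact.
  + by apply: hausdorff_product => _; exact: Rhausdorff.
  + by move=> x y _ _; exact: coord_inj.
Qed.

End james_tree_determined.

(** * Equivalent norms on the dual *)

Section sublinear_averages.
Context {R : realType} d {T : porderType d}.

Local Notation JT := (@james_tree_space R d T).

Lemma infinite_set_seq (I : Type) (A : set I) : infinite_set A ->
  exists2 f : nat -> I, (forall n, A (f n)) & injective f.
Proof.
move=> /infiniteP/card_leP[f]; exists (fun n => \val (f (to_setT n))).
  by move=> n; exact/set_mem/valP.
move=> m n /val_inj fmn; have : to_setT m = to_setT n.
  by apply: (inj (f := f)) fmn; rewrite inE.
by move/(congr1 val).
Qed.

(** Homogeneity is asked only for nonnegative scalars, so that both norms and linear functionals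
    qualify as [p]. *)
Lemma sublinear_sum (W : lmodType R) (p : W -> R) (I : Type) (r : seq I) (F : I -> W) :
  (forall x y, p (x + y) <= p x + p y) ->
  (forall a x, 0 <= a -> p (a *: x) = a * p x) ->
  p (\sum_(i <- r) F i) <= \sum_(i <- r) p (F i).
Proof.
move=> pD pZ; elim: r => [|i r IHr].
  by rewrite !big_nil -(scale0r 0) pZ// mul0r.
by rewrite !big_cons; apply: le_trans (pD _ _) _; rewrite lerD2l.
Qed.

(* Averages of functionals of disjoint segments tend to [0] in norm, by their
   upper 2-estimate. *)
Lemma sublinear_le_seg_perturbation (p : dual JT -> R) (C M b : R) (I : Type)
    (s : I -> set T) (A : set I) (x : dual JT) :
  (forall y z, p (y + z) <= p y + p z) ->
  (forall a y, 0 <= a -> p (a *: y) = a * p y) ->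
  0 <= C -> (forall y, p y <= C * `|y|) ->
  (forall i, segment (s i)) -> trivIset setT s -> infinite_set A ->
  (forall i, A i -> p (x + b *: seg_fun (s i)) <= M) -> p x <= M.
Proof.
move=> pD pZ C0 pC ss ts /infinite_set_seq[f fA finj] AM.
rewrite leNgt; apply/negP => Mx; pose e := p x - M.
have e0 : 0 < e by rewrite subr_gt0.
(* With [n = m.+1] terms, the average of the perturbations [b *: psi i] has norm at most [|b|] over
   the square root of [n], and [p] of the average of the perturbed points is at most [M]. *)
have bound m : e ^+ 2 <= (C * b) ^+ 2 / m.+1%:R.
  set n := m.+1; have n0 : n%:R != 0 :> R by rewrite pnatr_eq0.
  pose psi (i : 'I_n) := seg_fun (s (f i)) : dual JT.
  pose a (i : 'I_n) : R := - (n%:R^-1 * b).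
  have xE : x = \sum_(i < n) n%:R^-1 *: (x + b *: psi i) + \sum_(i < n) a i *: psi i.
    rewrite -big_split /= (eq_bigr (fun=> n%:R^-1 *: x)) => [|i _].
      by rewrite sumr_const card_ord -scaler_nat scalerA mulfV// scale1r.
    by rewrite /a scalerDr scalerA scaleNr addrK.
  have pavg : p (\sum_(i < n) n%:R^-1 *: (x + b *: psi i)) <= M.
    apply: le_trans (sublinear_sum _ _ pD pZ) _.
    apply: (@le_trans _ _ (\sum_(i < n) n%:R^-1 * M)).
      by apply: ler_sum => i _; rewrite pZ ?invr_ge0// ler_wpM2l ?invr_ge0//; exact/AM/fA.
    by rewrite sumr_const card_ord -[leLHS]mulr_natl mulrA mulfV// mul1r.
  have normE : \sum_i a i ^+ 2 = b ^+ 2 / n%:R.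
    rewrite /a sumr_const card_ord -[LHS]mulr_natl.
    by move: n0; move: (n%:R : R) => v v0; field.
  have pe : e <= C * Num.sqrt (b ^+ 2 / n%:R).
    rewrite lerBlDl {1}xE; apply: le_trans (pD _ _) _; apply: lerD => //.
    apply: le_trans (pC _) _; apply: ler_wpM2l => //; rewrite -normE.
    apply: (@seg_fun_sum_norm _ _ _ _ (fun i : 'I_n => s (f i))) => //.
    by move=> i j _ _ sij; apply/val_inj/finj/ts.
  rewrite -[leRHS](_ : (C * Num.sqrt (b ^+ 2 / n%:R)) ^+ 2 = _).
    by rewrite ler_sqr ?nnegrE ?(ltW e0)// mulr_ge0// sqrtr_ge0.
  rewrite exprMn sqr_sqrtr ?exprMn ?mulrA// divr_ge0 ?sqr_ge0//.
pose m := Num.bound ((C * b) ^+ 2 / e ^+ 2).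
have := bound m; rewrite leNgt => /negP; apply.
rewrite ltr_pdivrMr// -ltr_pdivrMl ?exprn_gt0// mulrC.
apply: (@lt_trans _ _ m%:R); last by rewrite ltr_nat.
by apply: archi_boundP; rewrite divr_ge0 ?sqr_ge0.
Qed.

End sublinear_averages.

Section branch_functionals.
Context {R : realType} d {T : porderType d}.
Hypothesis treeT : is_tree T.

Local Notation JT := (@james_tree_space R d T).

Definition below (t : T) : set T := [set r | (r <= t)%O].

Definition between (t u : T) : set T := [set r | (t < r <= u)%O].

Lemma below_segment t : segment (below t).
Proof.
split=> [r s|x y z xy yz _]; first exact: tree_total.
by move=> /(lt_le_trans yz)/ltW.
Qed.

Lemma between_segment t u : segment (between t u).
Proof.
split=> [r s /andP[_ ru] /andP[_ su]|x y z xy yz /andP[tx _] /andP[_ zu]].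
  exact: tree_total ru su.
by apply/andP; split; [exact: lt_trans xy|exact: ltW (lt_le_trans yz zu)].
Qed.

Definition branch (t : T) : dual JT := seg_fun (below t).

Lemma branch_between t u : (t <= u)%O ->
  branch u = branch t + seg_fun (between t u).
Proof.
move=> tu; apply: seg_fun_setU.
- exact: below_segment.
- exact: below_segment.
- exact: between_segment.
- apply/seteqP; split => [r ru|r [rt|/andP[]//]]; last exact: le_trans tu.
  have [rt|tr] := tree_total treeT ru tu; first by left.
  have [->|tr'] := eqVneq r t; first by left; exact: lexx.
  by right; rewrite /between /= lt_neqAle eq_sym tr' tr.
- by apply/seteqP; split => // r [rt /andP[tr _]]; have := lt_le_trans tr rt; rewrite ltxx.
Qed.

Lemma branch_norm_ge1 t : 1 <= `|branch t|.
Proof. by apply: (@seg_fun_norm_ge1 _ _ _ _ t); [exact: below_segment|exact: lexx]. Qed.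

Lemma between_norm_ge1 t u : (t < u)%O -> 1 <= `|seg_fun (between t u) : dual JT|.
Proof.
move=> tu; apply: (@seg_fun_norm_ge1 _ _ _ _ u); first exact: between_segment.
by rewrite /between /= tu lexx.
Qed.

Variable N : dual JT -> R.
Hypothesis eqN : equivalent_norm N.

Let ND x y : N (x + y) <= N x + N y. Proof. by have [] := eqN. Qed.

Let NZ a x : N (a *: x) = `|a| * N x. Proof. by have [] := eqN. Qed.

Let NZ_ge0 a x : 0 <= a -> N (a *: x) = a * N x.
Proof. by move=> a0; rewrite NZ ger0_norm. Qed.

Let N_bounds : exists c C : R, [/\ 0 < c, 0 < C & forall x, c * `|x| <= N x <= C * `|x|].
Proof. by have [] := eqN. Qed.

Lemma equivalent_norm_ge0 x : 0 <= N x.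
Proof.
have [c [C [c0 _ /(_ x)/andP[cN _]]]] := N_bounds.
by apply: le_trans cN; rewrite mulr_ge0// ltW.
Qed.

Lemma norm_le_seg_perturbation (M b : R) (I : Type) (s : I -> set T) (A : set I) x :
  (forall i, segment (s i)) -> trivIset setT s -> infinite_set A ->
  (forall i, A i -> N (x + b *: seg_fun (s i)) <= M) -> N x <= M.
Proof.
have [c [C [_ C0 NC]]] := N_bounds => ss ts A0 AM.
apply: (@sublinear_le_seg_perturbation _ _ _ N C M b I s A x) => //.
- exact: ltW.
- by move=> y; have /andP[] := NC y.
Qed.

(** Passing to the infimum over extensions makes the function monotone in [t], as Kurepa's argument
    requires. *)
Definition branch_inf (t : T) : R := inf [set N (branch u) | u in [set u | (t <= u)%O]].

Let branch_has_inf t : has_inf [set N (branch u) | u in [set u | (t <= u)%O]].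
Proof.
split; first by exists (N (branch t)), t => //=; exact: lexx.
by exists 0 => _ [u _ <-]; exact: equivalent_norm_ge0.
Qed.

Lemma branch_inf_le t u : (t <= u)%O -> branch_inf t <= N (branch u).
Proof. by move=> tu; apply: ge_inf; [have [] := branch_has_inf t|exists u]. Qed.

Lemma branch_inf_homo s t : (s <= t)%O -> branch_inf s <= branch_inf t.
Proof.
move=> st; apply: lb_le_inf; first by have [] := branch_has_inf t.
by move=> _ [u tu <-]; apply: branch_inf_le; exact: le_trans tu.
Qed.

(** Above each [s i] some [u i] nearly attains the common infimum. The functionals [branch (u i)]
    are perturbations of [branch t] by disjoint segments, so averaging gives [branch t] the same
    bound. *)
Lemma fan_branch_inf (I : Type) t (s : I -> T) : infinite_set [set: I] -> fan t s ->
  (forall i, branch_inf (s i) = branch_inf t) -> N (branch t) = branch_inf t.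
Proof.
move=> I0 [ts sdis] sE; apply/eqP; rewrite eq_le (branch_inf_le (lexx t)) andbT.
apply/ler_addgt0Pr => e e0.
have /choice[u uP] i : exists u, (s i <= u)%O /\ N (branch u) < branch_inf t + e.
  have [_ [u su <-] uP] := inf_adherent e0 (branch_has_inf (s i)).
  by exists u; split => //; rewrite -(sE i).
apply: (norm_le_seg_perturbation (b := 1) (s := fun i => between t (u i)) _ _ I0).
- by move=> i; exact: between_segment.
- by apply: sdis => i; have [] := uP i.
move=> i _; have [su /ltW] := uP i; rewrite scale1r -branch_between//.
exact: le_trans (ltW (ts i)) su.
Qed.

End branch_functionals.

Lemma finite_set_nat_near (A : set nat) : finite_set A ->
  \forall n \near \oo, ~ A n.
Proof.
move=> /finite_seqP[r ->]; exists (\max_(i <- r) i).+1 => // n /= rn nr.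
by move: rn; rewrite ltnNge (leq_bigmax_seq (F := id)).
Qed.

(** * Failure of strict convexity and of the Kadec property *)

Section norms_constant_on_fans.
Context {R : realType} d {T : porderType d}.
Hypothesis treeT : is_tree T.

Local Notation JT := (@james_tree_space R d T).

Variable N : dual JT -> R.
Hypothesis eqN : equivalent_norm N.
Context {I : Type} (t : T) (s : I -> T).
Hypothesis fan_s : fan t s.
Hypothesis N_const : forall i, N (branch (s i)) = N (branch t).

Let c := N (branch t).

Let ND x y : N (x + y) <= N x + N y. Proof. by have [] := eqN. Qed.

Let NZ a x : N (a *: x) = `|a| * N x. Proof. by have [] := eqN. Qed.

Let psi i : dual JT := seg_fun (between t (s i)).

Let branchE i : branch (s i) = branch t + psi i.
Proof. by apply: (branch_between treeT); apply: ltW; case: fan_s. Qed.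

Let psi_segment i : segment (between t (s i)).
Proof. exact: between_segment. Qed.

Let psi_disjoint : trivIset setT (fun i => between t (s i)).
Proof. by case: fan_s => _; apply. Qed.

Let N_lower : exists2 a, 0 < a & forall x, 1 <= `|x| -> a <= N x.
Proof.
have [_ _ _ [a [b [a0 _ Nab]]]] := eqN; exists a => // x x1.
have /andP[+ _] := Nab x; apply: le_trans.
by rewrite -[leLHS]mulr1 ler_wpM2l// ltW.
Qed.

Let c_gt0 : 0 < c.
Proof.
have [a a0 aN] := N_lower; apply: lt_le_trans a0 (aN _ _).
exact: branch_norm_ge1.
Qed.

Let psi_norm_ge1 i : 1 <= `|psi i|.
Proof. by apply: between_norm_ge1 => //; case: fan_s. Qed.

(** [N] is convex with value [c] at [branch t] and at every [branch (s i)]. For some [i] it does not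
    drop at the midpoint, so it is constant on that whole segment. *)
Lemma fan_not_strictly_convex : ~ countable [set: I] -> ~ strictly_convex_norm N.
Proof.
move=> uncI; apply; have [i ci] : exists i, c <= N (branch t + 2^-1 *: psi i).
  apply: contrapT => /forallNP nc; apply: uncI.
  (* If every midpoint dropped below [c], uncountability would give infinitely many drops by at
     least one fixed [n.+1%:R^-1], and averaging would then yield [N (branch t) < c]. *)
  have cover : [set: I] `<=` \bigcup_(n in [set: nat])
      [set i | N (branch t + 2^-1 *: psi i) <= c - n.+1%:R^-1].
    move=> i _; have lti : 0 < c - N (branch t + 2^-1 *: psi i).
      by rewrite subr_gt0 ltNge; apply/negP.
    have [n _ nP] := near_infty_natSinv_lt (PosNum lti).
    exists n => //=; have /= := nP n (leqnn n).
    by move=> /ltW; rewrite lerBrDr addrC -lerBrDr.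
  apply: sub_countable (subset_card_le cover) _.
  apply: bigcup_countable => // n _; apply: finite_set_countable.
  apply: contrapT => infA.
  have := norm_le_seg_perturbation eqN (M := c - n.+1%:R^-1) (x := branch t)
    psi_segment psi_disjoint infA (fun i => id).
  by rewrite lerDl oppr_ge0 leNgt invr_gt0 ltr0n.
have cN0 : c != 0 by rewrite gt_eqF.
have q_le (l : R) : 0 <= l <= 1 -> N (branch t + l *: psi i) <= c.
  move=> /andP[l0 l1].
  have -> : branch t + l *: psi i = (1 - l) *: branch t + l *: branch (s i).
    by rewrite branchE scalerDr addrA -scalerDl subrK scale1r.
  apply: le_trans (ND _ _) _; rewrite !NZ N_const -/c !ger0_norm ?subr_ge0//.
  by rewrite -mulrDl subrK mul1r.
(* The midpoint is the mean of the points with parameters [l] and [1 - l]; the second has norm at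
   most [c], so the first has norm at least [c]. *)
have q_ge (l : R) : 0 <= l <= 1 -> c <= N (branch t + l *: psi i).
  move=> /andP[l0 l1].
  have qE : branch t + 2^-1 *: psi i =
      2^-1 *: (branch t + l *: psi i) + 2^-1 *: (branch t + (1 - l) *: psi i).
    have half1 : 2^-1 + 2^-1 = 1 :> R by lra.
    rewrite !scalerDr addrACA -scalerDl half1 scale1r; congr (_ + _).
    by rewrite -scalerDr -scalerDl addrC subrK scale1r.
  have q1l : N (branch t + (1 - l) *: psi i) <= c.
    by apply: q_le; rewrite subr_ge0 l1 /= gerBl.
  move: ci; rewrite qE => /le_trans /(_ (ND _ _)).
  by rewrite !NZ ger0_norm ?invr_ge0//; lra.
exists (c^-1 *: branch t), (c^-1 *: branch (s i)); split.
  move=> /(scalerI (invr_neq0 cN0)) /eqP; rewrite branchE addrC -subr_eq subrr.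
  move=> /eqP psi0; have := psi_norm_ge1 i.
  by rewrite -psi0 normr0 ler10.
move=> l l01; rewrite /unit_sphere /=.
have -> : (1 - l) *: (c^-1 *: branch t) + l *: (c^-1 *: branch (s i)) =
    c^-1 *: (branch t + l *: psi i).
  rewrite !scalerA ![_ * c^-1]mulrC -!scalerA -scalerDr; congr (_ *: _).
  by rewrite branchE scalerDr addrA -scalerDl subrK scale1r.
rewrite NZ gtr0_norm ?invr_gt0//; apply/eqP; rewrite eq_sym.
have -> : N (branch t + l *: psi i) = c by apply/le_anti; rewrite q_le ?q_ge.
by rewrite mulVf.
Qed.

(** The points [y n] of the sphere converge weakly to [x] but keep [N]-distance at least [c^-1 * a]
    from it. *)
Lemma fan_not_kadec : infinite_set [set: I] -> ~ kadec_norm N.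
Proof.
move=> /infinite_set_seq[f _ finj] kN; have [a a0 aN] := N_lower.
have cN0 : c != 0 by rewrite gt_eqF.
pose x := c^-1 *: branch t; pose y n := c^-1 *: branch (s (f n)).
have yE n : y n = x + c^-1 *: psi (f n) by rewrite /y branchE scalerDr.
have xS : unit_sphere N x.
  by rewrite /unit_sphere /= NZ gtr0_norm ?invr_gt0// mulVf.
have yS n : unit_sphere N (y n).
  by rewrite /unit_sphere /= NZ N_const gtr0_norm ?invr_gt0// mulVf.
pose U := [set z : dual JT | N (z - x) < c^-1 * a].
have oU : norm_open N U.
  move=> z Uz; exists (c^-1 * a - N (z - x)); first by rewrite subr_gt0.
  move=> w; rewrite ltrBrDr; apply: le_lt_trans.
  by apply: le_trans (ND _ _); rewrite addrA subrK.
have [W oW WU] : [set U `&` unit_sphere N | U in @open (weak (dual JT))]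
    (U `&` unit_sphere N) by rewrite -kN; exists U.
have N0 : N 0 = 0 by rewrite -(scale0r 0) NZ normr0 mul0r.
have Wx : W x.
  have : (U `&` unit_sphere N) x.
    by split => //; rewrite /U /= subrr N0 mulr_gt0// invr_gt0.
  by rewrite -WU => -[].
(* If [Psi] were at least [e] on infinitely many [psi (f n)], averaging with the sublinear map
   [- Psi] at 0 would give [0 <= - e]. Applying this to [Phi] and [- Phi] bounds both signs. *)
have psi_weak (Phi : dual (dual JT)) : (fun n => Phi (psi (f n)) : R) @ \oo --> (0 : R).
  have half (Psi : dual (dual JT)) e : 0 < e ->
      finite_set [set n | e <= Psi (psi (f n))].
    move=> e0; apply: contrapT => infA.
    have ss n : segment (between t (s (f n))) by exact: psi_segment.
    have ts : trivIset setT (fun n => between t (s (f n))).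
      by move=> m n _ _ mn; apply/finj/psi_disjoint.
    have : - Psi 0 <= - e.
      apply: (@sublinear_le_seg_perturbation _ _ _ (fun z => - Psi z) `|Psi|
        (- e) 1 nat _ _ 0 _ _ _ _ ss ts infA) => //.
      - by move=> u v; rewrite dual_applyD opprD.
      - by move=> l u _; rewrite dual_applyZ mulrN.
      - by move=> u; apply: le_trans (dual_norm_le Psi u); rewrite ler_normr lexx orbT.
      - by move=> n /=; rewrite add0r scale1r lerN2.
    by rewrite dual_apply0 lerN2 leNgt e0.
  apply/cvgr0Pnorm_lt => e e0.
  have nP := finite_set_nat_near (half Phi _ e0).
  have nN := finite_set_nat_near (half (- Phi) _ e0).
  near=> n; rewrite ltr_norml; apply/andP; split.
    rewrite ltrNl ltNge; apply/negP.
    by change (~ [set n | e <= (- Phi) (psi (f n))] n); near: n.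
  rewrite ltNge; apply/negP.
  by change (~ [set n | e <= Phi (psi (f n))] n); near: n.
have yW : \forall n \near \oo, W (y n).
  (* [W] is the preimage of an open set of the product indexed by the bidual, so pointwise
     convergence on the bidual suffices. *)
  have [B oB BW] := oW.
  have Bx : B (fun Phi : dual (dual JT) => Phi x) by rewrite -BW in Wx.
  have cvgy : (fun n => (fun Phi : dual (dual JT) => Phi (y n) : R)) @ \oo -->
      ((fun Phi : dual (dual JT) => Phi x : R) : {ptws dual (dual JT) -> R}).
    apply: cvg_ptws => Phi.
    have yE' : (fun n => Phi x + c^-1 * Phi (psi (f n))) = (fun n => Phi (y n) : R).
      by apply/funext => n; rewrite yE dual_applyD (dual_applyZ Phi _ (psi (f n))).
    have : (fun n => Phi (y n) : R) @ \oo --> (Phi x + c^-1 * 0 : R).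
      by rewrite -yE'; exact: cvgD (@cvg_cst _ _ _ _ _) (cvgMr (psi_weak Phi)).
    by rewrite mulr0 addr0; exact.
  have := cvgy B (open_nbhs_nbhs (conj oB Bx)); rewrite -BW; exact.
have [n _ /(_ n (leqnn n)) Wy] := yW.
have : (U `&` unit_sphere N) (y n) by rewrite -WU.
case; rewrite /U /= yE addrAC subrr add0r NZ gtr0_norm ?invr_gt0//.
by rewrite ltr_pM2l ?invr_gt0// ltNge aN.
Unshelve. all: by end_near. Qed.

End norms_constant_on_fans.

(** The unit interval has Lebesgue measure 1, whereas countable sets are null. *)
Lemma real_uncountable (R : realType) : ~ countable [set: R].
Proof.
move=> cR; have c01 : countable (`[0, 1]%classic : set R).
  by apply: sub_countable cR; exact: subset_card_le.
have := countable_lebesgue_measure0 c01.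
by rewrite lebesgue_measure_itv /= lte_fin ltr01 sube0 => /eqP; rewrite eqe oner_eq0.
Qed.

(** The infimum is attained at [t] through the fan [s], and at each [s g] through its own countable
    fan; both infima agree, which makes [N] constant. *)
Lemma wotree_lexi_fan (R : realType)
    (N : dual (@james_tree_space R _ (wotree (R *l R))) -> R) : equivalent_norm N ->
  exists (t : wotree (R *l R)) (s : R -> wotree (R *l R)), fan t s /\
    forall g, N (branch (s g)) = N (branch t).
Proof.
move=> eqN; have treeT := @wotree_is_tree _ (R *l R)%type.
have [t [s [ts sP]]] := wotree_lexi_const (branch_inf_homo eqN).
exists t, s; split => // g.
have -> : N (branch t) = branch_inf N t.
  apply: (fan_branch_inf treeT eqN _ ts) => [|h]; last by have [] := sP h.
  by move=> /finite_set_countable; exact: real_uncountable.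
have [<- [s' [sg' s'E]]] := sP g.
apply: (fan_branch_inf treeT eqN infinite_nat sg') => n.
by rewrite s'E; have [] := sP g.
Qed.

Theorem mainTheorem1 (R : realType) :
  exists (d : Order.disp_t) (T : porderType d) (JT : completeNormedModType R),
    [/\ is_tree T,
        is_james_tree_space T JT,
        weakly_Lindelof_determined JT,
        ~ (exists N : dual JT -> R, equivalent_norm N /\ strictly_convex_norm N) &
        ~ (exists N : dual JT -> R, equivalent_norm N /\ kadec_norm N)].
Proof.
have treeT := @wotree_is_tree _ (R *l R)%type.
exists wotree_display, (wotree (R *l R)), (@james_tree_space R _ (wotree (R *l R))).
split=> //.
- exact: james_tree_spaceP.
- apply: james_tree_space_wld => // C; apply: wotree_chain_countable.
  exact: wo_set_lexi_countable.
- move=> [N [eqN scN]]; have [t [s [ts sE]]] := wotree_lexi_fan eqN.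
  by case: (fan_not_strictly_convex treeT eqN ts sE _ scN); exact: real_uncountable.
- move=> [N [eqN kN]]; have [t [s [ts sE]]] := wotree_lexi_fan eqN.
  case: (fan_not_kadec treeT eqN ts sE _ kN) => /finite_set_countable.
  exact: real_uncountable.
Qed.
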